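(* Let $V,W$ be finite-dimensional real Banach spaces, $F$ a real Banach space, $S$ a finite-dimensional Banach space, $p,q\in[1,\infty)$, $\kappa=\lfloor p\rfloor$, $\lambda=\lfloor q\rfloor$. Let $\mathbf X\in\Omega G_{p,\omega_{\mathbf X}}([a,b],V)$, $\mathbf Y\in\Omega G_{q,\omega_{\mathbf Y}}([c,d],W)$, let $g:F\to S$ be Fréchet smooth, and let $Z\in\mathcal D^{p,q}_{\mathbf X,\mathbf Y}([a,b]\times[c,d],F)$ be a two-parameter $(\mathbf X,\mathbf Y)$-controlled path. Then the composition $g(Z)$, defined at level $(0,0)$ by $g(Z)^{(0,0)}_{t,v}=g(Z^{(0,0)}_{t,v})$ and, for $\xi_j\in V^{\otimes j}$ $(0\le j<\kappa)$, $\eta_k\in W^{\otimes k}$ $(0\le k<\lambda)$, $(j,k)\ne(0,0)$, by $$g(Z)_{t,v}[\xi_j,\eta_k]=\begin{cases}\displaystyle\sum_{m=1}^{\kappa-1}\frac1{m!}D^mg(Z^{(0,0)}_{t,v})\circ Z_{t,v}^{\otimes m}\circ(\tilde\Delta^m\boxtimes\mathrm{id})[\xi_j,\eta_k],&j>0,\ k=0,\\[1ex]\displaystyle\sum_{n=1}^{\lambda-1}\frac1{n!}D^ng(Z^{(0,0)}_{t,v})\circ Z_{t,v}^{\otimes n}\circ(\mathrm{id}\boxtimes\tilde\Delta^n)[\xi_j,\eta_k],&j=0,\ k>0,\\[1ex]\displaystyle\sum_{\ell=1}^{\lambda+\kappa-2}\frac1{\ell!}D^\ell g(Z^{(0,0)}_{t,v})\circ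 Z_{t,v}^{\otimes\ell}\circ\widetilde{(\Delta\boxtimes\Delta)}^{\ell}[\xi_j,\eta_k],&j>0,\ k>0,\end{cases}$$ is a two-parameter controlled path: $g(Z)\in\mathcal D^{p,q}_{\mathbf X,\mathbf Y}([a,b]\times[c,d],S)$.
   Context: Tensor conventions: $V^{\otimes k}$ carries the projective norm, $V^{\otimes 0}=\mathbb R$, $T((V))$ is the tensor algebra with unit $\mathbf 1$; $T^{<N}(V)$ is the truncation to levels $<N$; $\eta^{<k}$ is the projection on levels $<k$. $L_\eta(\xi)=\eta\otimes\xi$ is left multiplication (truncated when necessary). $\boxtimes$ is an external tensor product. $\Delta_{[a,b]}=\{(s,t):a\le s\le t\le b\}$. Rough paths: a control is a continuous superadditive $\omega:\Delta_{[a,b]}\to[0,\infty)$ vanishing on the diagonal; $C^p_\omega$ denotes maps whose value (increment) at $(s,t)$ is bounded by $C\omega(s,t)^{1/p}$, and $C^{0,p}_\omega$ is the closure of $C^1_\omega$ in $C^p_\omega$. $\Omega G_{p,\omega}([a,b],V)$ is the set of $\mathbf X\in C^{0,p}_\omega(\Delta_{[a,b]},G^{\lfloor p\rfloor}(V))$, where $G^N(V)$ is the step-$N$ nilpotent group with the Carnot–Carathéodory metric, with $\mathbf X_{s,s}=\mathbf 1$ and $\mathbf X_{s,u}=\mathbf X_{s,t}\otimes\mathbf X_{t,u}$. Two-parameter controlled paths: $\mathcal D^{p,q}_{\mathbf X,\mathbf Y}([a,b]\times[c,d],F)$ is the set of $Z:[a,b]\times[c,d]\to\mathrm{Hom}(T^{<\kappa}(V)\boxtimes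 T^{<\lambda}(W),F)$ such that the remainders defined by $Z_{t,u}=Z_{s,u}\circ[L_{\mathbf X^{<\kappa}_{s,t}}\boxtimes\mathrm{id}]+R^1_{s,t}(u)$ and $Z_{s,v}=Z_{s,u}\circ[\mathrm{id}\boxtimes L_{\mathbf Y^{<\lambda}_{u,v}}]+R^2_{u,v}(s)$ satisfy, for some finite $C_1,C_2$ and all $a\le s\le t\le b$, $c\le u\le v\le d$, $\|R^1_{s,t}(u)[\eta_j\boxtimes\xi]\|\le C_1\omega_{\mathbf X}(s,t)^{(\kappa-j)/p}\|\eta_j\|\|\xi\|$ for $\eta_j\in V^{\otimes j}$, $0\le j<\kappa$, and $\|R^2_{u,v}(s)[\eta\boxtimes\xi_k]\|\le C_2\omega_{\mathbf Y}(u,v)^{(\lambda-k)/q}\|\eta\|\|\xi_k\|$ for $\xi_k\in W^{\otimes k}$, $0\le k<\lambda$. $Z^{(j,k)}$ is the restriction of $Z$ to $V^{\otimes j}\boxtimes W^{\otimes k}$; $Z^{(0,0)}$ is identified with an $F$-valued function (the trace). Coproducts: $\Delta$ is the shuffle coproduct, the algebra morphism with $\Delta(v)=v\boxtimes\mathbf 1+\mathbf 1\boxtimes v$ for $v\in V$; $\Delta^m\eta=\sum\eta_1\boxtimes\cdots\boxtimes\eta_m$ is its iterate with $m$ tensor factors. $\tilde\Delta^m$ keeps only the terms in which all factors $\eta_i$ have level $\ge1$. In the $(j,0)$ case $Z^{\otimes m}$ is evaluated on $(\eta_1\boxtimes\mathbf 1)\otimes\cdots\otimes(\eta_m\boxtimes\mathbf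 1)$, and symmetrically in the $(0,k)$ case. $\widetilde{(\Delta\boxtimes\Delta)}^\ell[\xi,\eta]=\sum(\xi_1\boxtimes\eta_1)\otimes\cdots\otimes(\xi_\ell\boxtimes\eta_\ell)$, where $\Delta^\ell\xi=\sum\xi_1\boxtimes\cdots\boxtimes\xi_\ell$, $\Delta^\ell\eta=\sum\eta_1\boxtimes\cdots\boxtimes\eta_\ell$ and only terms in which no factor $\xi_i\boxtimes\eta_i$ has bidegree $(0,0)$ are kept. $D^mg$ is the $m$-th Fréchet derivative, a symmetric $m$-linear map. *)

(* Defs.v *)
From HB Require Import structures.
From mathcomp Require Import all_boot all_order all_algebra.
From mathcomp Require Import all_classical all_reals all_analysis.

Set Implicit Arguments.
Unset Strict Implicit.
Unset Printing Implicit Defensive.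

Import Order.TTheory GRing.Theory Num.Theory.
Import numFieldNormedType.Exports.

Local Open Scope classical_set_scope.
Local Open Scope ring_scope.

#[short(type="finBanachType")]
HB.structure Definition FinBanach (R : realType) :=
  {V of CompleteNormedModule R V & Vector R V}.

(* Tensors over V are stored as arrays of coordinates in the basis
   [vbasis fullv] of V: letters index this basis, and a word i_1 ... i_j stands
   for the tensor e_{i_1} (x) ... (x) e_{i_j}. *)
Notation letter V := ('I_(\dim (@fullv _ V))).
Notation word V N := {w : N.-bseq (letter V) | (size w < N)%N}.

(* The tensor power of order j; the truncation to levels < N of the tensor
   algebra; the external product of two such truncations. *)
Notation tpow R V j := {ffun j.-tuple (letter V) -> R^o}.
Notation tens R V N := {ffun word V N -> R^o}.
Notation tens2 R V N W M := {ffun word V N * word W M -> R^o}.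

Section TensorAlgebra.
Context {R : realType} {V : finBanachType R}.

Definition wseq N (u : word V N) : seq (letter V) := val (val u).

Definition pure_tensor j (v : 'I_j -> V) : tpow R V j :=
  [ffun w => \prod_(i < j) coord (vbasis fullv) (tnth w i) (v i)].

(* The scalars c i matter only at level 0, where [pure_tensor v] is 1. *)
Definition projnorm j (x : tpow R V j) : R :=
  inf [set r | exists m (c : 'I_m -> R) (v : 'I_m -> 'I_j -> V),
    x = \sum_i c i *: pure_tensor (v i) /\
    r = \sum_i `|c i| * \prod_l `|v i l|].

Section Truncated.
Context {N : nat}.
Local Notation T := (tens R V N).

Definition coef (x : T) (w : seq (letter V)) : R :=
  \sum_(u : word V N | wseq u == w) x u.

(* Zero when w has length >= N. *)
Definition tword (w : seq (letter V)) : T := [ffun u => (wseq u == w)%:R].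

Definition tone : T := tword [::].

Definition tmul (x y : T) : T :=
  [ffun u => \sum_(i < (size (wseq u)).+1)
               coef x (take i (wseq u)) * coef y (drop i (wseq u))].

Definition level j (x : T) : tpow R V j :=
  [ffun w : j.-tuple (letter V) => coef x w].

(* Zero when j >= N. *)
Definition inlevel j (x : tpow R V j) : T :=
  [ffun u => \sum_(w : j.-tuple (letter V) | tval w == wseq u) x w].

(* Sum over the levels of the projective norms. *)
Definition tnorm (x : T) : R := \sum_(j < N) projnorm (level j x).

Definition tvec (v : V) : T := inlevel (pure_tensor (fun _ : 'I_1 => v)).

(* Used only on x without level-0 part, for which x ^ N = 0. *)
Definition texp (x : T) : T :=
  \sum_(k < N) ((k`!)%:R : R)^-1 *: iter k (tmul x) tone.

Inductive free_lie : T -> Prop :=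
| lie_vec v : free_lie (tvec v)
| lie_add x y : free_lie x -> free_lie y -> free_lie (x + y)
| lie_scale (c : R) x : free_lie x -> free_lie (c *: x)
| lie_bracket x y :
    free_lie x -> free_lie y -> free_lie (tmul x y - tmul y x).

End Truncated.

Definition truncate N k (x : tens R V N) : tens R V k :=
  [ffun u => coef x (wseq u)].

(* The step-N nilpotent group G^N(V), the exponential of the free step-N
   nilpotent Lie algebra; it lives in levels <= N. *)
Definition nilgroup N (x : tens R V N.+1) : Prop :=
  exists l, free_lie l /\ x = texp l.

(* C^1 horizontal curves on [0,1]: gamma' = gamma (x) u with u valued in V. *)
Definition horizontal N (u : R -> V) (gamma : R -> tens R V N.+1) : Prop :=
  [/\ {within `[0, 1], continuous u},
      forall t : R, 0 <= t <= 1 -> nilgroup (gamma t),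
      forall w, {within `[0, 1], continuous (fun t : R => gamma t w)} &
      forall (t : R) w, 0 < t < 1 ->
        is_derive (t : R^o) 1 (fun s : R^o => gamma s w)
          (tmul (gamma t) (tvec (u t)) w)].

(* The Carnot-Caratheodory distance, with value +oo if no horizontal curve
   joins the two points. *)
Definition cc_dist N (x y : tens R V N.+1) : \bar R :=
  ereal_inf [set L | exists u gamma,
    [/\ horizontal u gamma, gamma 0 = x, gamma 1 = y &
        L = (\int[lebesgue_measure]_(t in `[0%R, 1%R]) (`|u t|%:E))%E]].

End TensorAlgebra.

Section RoughPaths.
Context {R : realType}.

Definition control (a b : R) (omega : R -> R -> R) : Prop :=
  [/\ {within [set x : R * R | a <= x.1 /\ x.1 <= x.2 /\ x.2 <= b],
        continuous (fun x => omega x.1 x.2)},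
      forall s t, a <= s -> s <= t -> t <= b -> 0 <= omega s t,
      forall s t u, a <= s -> s <= t -> t <= u -> u <= b ->
        omega s t + omega t u <= omega s u &
      forall s, a <= s -> s <= b -> omega s s = 0].

Context {V : finBanachType R}.

(* X belongs to C^p_omega(Delta_[a,b], G^N(V)). *)
Definition Cpow N (p : R) (omega : R -> R -> R) (a b : R)
    (X : R -> R -> tens R V N.+1) : Prop :=
  (forall s t, a <= s -> s <= t -> t <= b -> nilgroup (X s t)) /\
  exists C : R, forall s t, a <= s -> s <= t -> t <= b ->
    (cc_dist tone (X s t) <= (C * omega s t `^ p^-1)%:E)%E.

(* X belongs to the closure C^{0,p}_omega of C^1_omega in C^p_omega. *)
Definition C0pow N (p : R) (omega : R -> R -> R) (a b : R)
    (X : R -> R -> tens R V N.+1) : Prop :=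
  Cpow p omega a b X /\
  forall e : R, 0 < e -> exists Y, Cpow 1 omega a b Y /\
    forall s t, a <= s -> s <= t -> t <= b ->
      (cc_dist (X s t) (Y s t) <= (e * omega s t `^ p^-1)%:E)%E.

Definition rough_path (p : R) (omega : R -> R -> R) (a b : R)
    (X : R -> R -> {ffun word V (Num.truncn p).+1 -> R^o}) : Prop :=
  [/\ C0pow p omega a b X,
      forall s, a <= s -> s <= b -> X s s = tone &
      forall s t u, a <= s -> s <= t -> t <= u -> u <= b ->
        X s u = tmul (X s t) (X t u)].

End RoughPaths.

Arguments rough_path {R V} p omega a b X.

Section TwoParameter.
Context {R : realType} {V W : finBanachType R} {kappa lambda : nat}.
Local Notation TT := (tens2 R V kappa W lambda).

Definition box (x : tens R V kappa)
    (y : tens R W lambda) : TT :=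
  [ffun w => x w.1 * y w.2].

(* The tensor product of two linear maps. *)
Definition boxmap
    (f : tens R V kappa -> tens R V kappa)
    (h : tens R W lambda -> tens R W lambda)
    (A : TT) : TT :=
  \sum_w (A w : R) *: box (f (tword (wseq w.1))) (h (tword (wseq w.2))).

Context {F : normedModType R}.

Definition rem1 (X : R -> R -> tens R V kappa.+1)
    (Z : R -> R -> {linear TT -> F}) (s t u : R) (A : TT) : F :=
  Z t u A - Z s u (boxmap (tmul (truncate kappa (X s t))) id A).

Definition rem2 (Y : R -> R -> tens R W lambda.+1)
    (Z : R -> R -> {linear TT -> F}) (u v s : R) (A : TT) : F :=
  Z s v A - Z s u (boxmap id (tmul (truncate lambda (Y u v))) A).

Definition controlled2 (p q : R) (omegaX omegaY : R -> R -> R) (a b c d : R)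
    (X : R -> R -> tens R V kappa.+1)
    (Y : R -> R -> tens R W lambda.+1)
    (Z : R -> R -> {linear TT -> F}) : Prop :=
  (exists C1 : R, forall s t u, a <= s -> s <= t -> t <= b ->
     c <= u -> u <= d ->
     forall j (eta : tpow R V j)
       (xi : tens R W lambda), (j < kappa)%N ->
     `|rem1 X Z s t u (box (inlevel eta) xi)| <=
       C1 * omegaX s t `^ ((kappa%:R - j%:R) / p) * projnorm eta * tnorm xi)
  /\
  (exists C2 : R, forall u v s, c <= u -> u <= v -> v <= d ->
     a <= s -> s <= b ->
     forall k (eta : tens R V kappa)
       (xi : tpow R W k), (k < lambda)%N ->
     `|rem2 Y Z u v s (box eta (inlevel xi))| <=
       C2 * omegaY u v `^ ((lambda%:R - k%:R) / q) * tnorm eta * projnorm xi).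

End TwoParameter.

Section Frechet.
Context {R : realType} {F S : normedModType R}.

(* D^m g (x) [v_1, ..., v_m], for m the size of vs; the first entry of vs is
   the direction differentiated last. *)
Fixpoint frechet (g : F -> S) (vs : seq F) (x : F) : S :=
  if vs is v :: vs' then 'd (frechet g vs') x v else g x.

(* For all m, D^m g takes values in the bounded m-linear maps and is, for the
   operator norm, Frechet differentiable everywhere with derivative
   D^(m+1) g. *)
Definition frechet_smooth (g : F -> S) : Prop :=
  forall (m : nat) (x : F),
    (exists C : R, forall vs : seq F, size vs = m ->
       `|frechet g vs x| <= C * \prod_(v <- vs) `|v|) /\
    (forall e : R, 0 < e -> \forall h \near (0 : F),
       forall vs : seq F, size vs = m ->
       `|frechet g vs (x + h) - frechet g vs x - frechet g (h :: vs) x|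
         <= e * `|h| * \prod_(v <- vs) `|v|).

End Frechet.

Section Coproduct.
Context {A : Type}.

(* Sums of tensor products of words are lists of their summands, with
   repetitions. The clause for i :: w is the product of i (x) 1 + 1 (x) i with
   the coproduct of w. *)
Fixpoint coprod (w : seq A) : seq (seq A * seq A) :=
  if w is i :: w' then
    [seq (i :: p.1, p.2) | p <- coprod w'] ++
    [seq (p.1, i :: p.2) | p <- coprod w']
  else [:: ([::], [::])].

(* The iterated coproduct with m tensor factors; it starts from the counit, so
   that m = 1 gives the identity. *)
Fixpoint coprod_iter (m : nat) (w : seq A) : seq (seq (seq A)) :=
  if m is m'.+1 then
    flatten [seq [seq p.1 :: t | t <- coprod_iter m' p.2] | p <- coprod w]
  else if nilp w then [:: [::]] else [::].

Definition rcoprod_iter (m : nat) (w : seq A) : seq (seq (seq A)) :=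
  [seq t <- coprod_iter m w | all (fun u => ~~ nilp u) t].

End Coproduct.

Definition rcoprod2_iter {A B : Type} (m : nat) (w : seq A) (w' : seq B) :
    seq (seq (seq A * seq B)) :=
  [seq t <- [seq zip x y | x <- coprod_iter m w, y <- coprod_iter m w']
         | all (fun u => ~~ (nilp u.1 && nilp u.2)) t].

Section Composition.
Context {R : realType} {V W : finBanachType R} {kappa lambda : nat}.
Context {F S : normedModType R}.
Local Notation TT := (tens2 R V kappa W lambda).
Variables (g : F -> S) (z : {linear TT -> F}).

Let zword (u : seq (letter V) * seq (letter W)) : F :=
  z (box (tword u.1) (tword u.2)).

Let trace : F := z (box tone tone).

Definition compose_word (w : seq (letter V)) (w' : seq (letter W)) : S :=
  match w, w' with
  | [::], [::] => g trace
  | _ :: _, [::] =>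
      \sum_(1 <= m < kappa) ((m`!)%:R : R)^-1 *:
        \sum_(t <- rcoprod_iter m w)
          frechet g [seq zword (u, [::]) | u <- t] trace
  | [::], _ :: _ =>
      \sum_(1 <= n < lambda) ((n`!)%:R : R)^-1 *:
        \sum_(t <- rcoprod_iter n w')
          frechet g [seq zword ([::], u) | u <- t] trace
  | _ :: _, _ :: _ =>
      \sum_(1 <= l < (lambda + kappa - 2).+1) ((l`!)%:R : R)^-1 *:
        \sum_(t <- rcoprod2_iter l w w')
          frechet g [seq zword u | u <- t] trace
  end.

(* The value of g(Z) at one point of the rectangle: the linear extension of its
   values on basis words. *)
Definition compose_ctrl (A : TT) : S :=
  \sum_w (A w : R) *: compose_word (wseq w.1) (wseq w.2).

Fact compose_ctrl_is_linear : linear compose_ctrl.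
Proof.
move=> c A B; rewrite /compose_ctrl scaler_sumr -big_split /=.
by apply: eq_bigr => w _; rewrite !ffunE scalerDl scalerA.
Qed.

HB.instance Definition _ :=
  GRing.isLinear.Build R TT S _ compose_ctrl compose_ctrl_is_linear.

End Composition.

(* Main.v *)
Require Import Defs.
From HB Require Import structures.
From mathcomp Require Import all_boot all_order all_algebra.
From mathcomp Require Import all_classical all_reals all_analysis.
From mathcomp Require Import ring lra zify.

(** Let [zeta (v, v')] be the value of [Z] on a pair of basis words. Since the
    derivatives of [g] are symmetric, the weights [1 / m!] of the coproduct
    formula count every set partition once, and the value of [g(Z)] on a pair of
    words [(w, w')] is the Faa di Bruno sum, over the set partitions of the
    letters of [w] and [w'] into blocks [b], of the derivative of [g] at the
    trace evaluated on the [zeta b] ([weighted_rcoprod2_partitions],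
    [compose_wordE]).

    For the first remainder the second variable is a parameter, and the error is
    the sum of two parts. Replacing [Z_t] by [Z_s] composed with the left
    multiplication by [X_(s,t)] changes [zeta] on a block [b] by
    [O(omega ^ ((kappa - |b|) / p))]; the blocks are at most as long as [w] and
    the Faa di Bruno sum is Lipschitz in [zeta] ([faa_di_bruno_lipschitz]).

    It remains to see that the Faa di Bruno sum almost commutes with the left
    multiplication by [X_(s,t)]. The usual argument is algebraic: [X_(s,t)] is
    group-like, and one expands [g] by the Taylor formula. Here [X_(s,t)] is
    only used as the end point of a horizontal curve [gamma] that starts at the
    unit and has length [L = O(omega ^ (1 / p))]. The derivative of [gamma]
    appends a letter [i]. In the Faa di Bruno sum of the shifted [zeta] this
    letter creates a new block, when the base point is differentiated, or
    enlarges an old one, so that the derivative at [w] is driven by the values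
    at the words [i :: w] ([faa_di_bruno_derivative]). The Faa di Bruno sum of
    [zeta], evaluated on [gamma] times [w], has the same property. Their
    difference [E_w] thus satisfies [E_w(0) = 0] and
    [E_w' = \sum_i u^i E_(i :: w)], while [E_w] is bounded when [w] has length
    [kappa], the truncation; integrating [kappa - |w|] times gives
    [E_w = O(L ^ (kappa - |w|))] ([shift_error_bound]).

    The constants are uniform because [Z] is bounded and continuous on the
    rectangle: the base points stay in a compact subset of [F], where the
    derivatives of [g] are bounded ([controlled_bounded_compact],
    [frechet_bounded_compact]). As [V] and [W] have finite dimension, estimates
    on basis words are enough ([controlled2_of_words]). The second remainder is
    the first one with the two words exchanged ([faa_di_bruno_swap]). *)

Set Implicit Arguments.
Unset Strict Implicit.
Unset Printing Implicit Defensive.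

Import Order.TTheory GRing.Theory Num.Theory.
Import numFieldNormedType.Exports.

Local Open Scope ring_scope.
Local Open Scope classical_set_scope.

(** * Iterated coproducts and set partitions *)

Section AlterOne.
Context {T : Type}.

Fixpoint alter_one (op : T -> T) (s : seq T) : seq (seq T) :=
  if s is b :: s' then (op b :: s') :: [seq b :: t | t <- alter_one op s']
  else [::].

Lemma sum_alter_one_cons (U : nmodType) (op : T -> T) b s (f : seq T -> U) :
  \sum_(t <- alter_one op (b :: s)) f t =
  f (op b :: s) + \sum_(t <- alter_one op s) f (b :: t).
Proof. by rewrite /= big_cons big_map. Qed.

Lemma sum_alter_one_cat (U : nmodType) (op : T -> T) s1 s2 (f : seq T -> U) :
  \sum_(t <- alter_one op (s1 ++ s2)) f t =
  \sum_(t <- alter_one op s1) f (t ++ s2) +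
  \sum_(t <- alter_one op s2) f (s1 ++ t).
Proof.
elim: s1 f => [|b s1 IH] f; first by rewrite big_nil add0r.
by rewrite cat_cons !sum_alter_one_cons IH addrA.
Qed.

Lemma size_alter_one op s : all (fun t => size t == size s) (alter_one op s).
Proof.
elim: s => //= b s IH; rewrite eqxx /= all_map; apply: sub_all IH => t /=.
by rewrite eqSS.
Qed.

Lemma all_alter_one (P Q : pred T) op s :
  (forall b, P b -> Q b) -> (forall b, P b -> Q (op b)) -> all P s ->
  all (all Q) (alter_one op s).
Proof.
move=> PQ PQop; elim: s => //= b s IH /andP[Pb Ps].
rewrite PQop // (sub_all PQ) //= all_map; apply: sub_all (IH Ps) => t /= ->.
by rewrite PQ.
Qed.

End AlterOne.

Definition perm_invariant {T : eqType} {U : Type} (f : seq T -> U) :=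
  forall s t, perm_eq s t -> f s = f t.

Lemma alter_one_perm (T : eqType) (U : nmodType) op (f : seq T -> U) :
  perm_invariant f -> perm_invariant (fun s => \sum_(t <- alter_one op s) f t).
Proof.
move=> fP; apply: catCA_perm_subst => s1 s2 s3.
rewrite !sum_alter_one_cat [RHS]addrCA.
congr (_ + (_ + _)); apply: eq_bigr => u _; apply: fP;
  by rewrite perm_catCA.
Qed.

(** The altered slot can be moved to the front, so that its [k] positions give
    the same value. *)
Lemma sum_alter_one_nseq (T : eqType) (U : nmodType) op (f : seq T -> U) s k e :
  perm_invariant f ->
  \sum_(t <- alter_one op (nseq k e)) f (s ++ t) =
  f (op e :: s ++ nseq k.-1 e) *+ k.
Proof.
move=> fP; elim: k s => [|k IH] s; first by rewrite big_nil.
rewrite /= big_cons big_map mulrS; congr (_ + _).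
  by apply: fP; rewrite perm_catC /= perm_cons perm_catC.
under eq_bigr do rewrite -cat_rcons.
rewrite IH; case: k {IH} => // k; congr (_ *+ _); apply: fP => /=.
by rewrite cat_rcons.
Qed.

Section Partitions.
Context {A B : Type}.
Local Notation block := (seq A * seq B)%type.

Definition consl i (b : block) : block := (i :: b.1, b.2).
Definition consr j (b : block) : block := (b.1, j :: b.2).

Definition add_letter (op : block -> block) (pi : seq block) :=
  (op ([::], [::]) :: pi) :: alter_one op pi.

(** The set partitions of the positions of a pair of words, each block being
    recorded as the pair of subwords that it cuts out: a letter put in front of
    a word is a new block or joins an old one. *)
Definition partitions (w : seq A) (w' : seq B) : seq (seq block) :=
  foldr (fun i P => flatten [seq add_letter (consl i) pi | pi <- P])
    (foldr (fun j P => flatten [seq add_letter (consr j) pi | pi <- P])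
       [:: [::]] w') w.

Lemma all_flatten_add_letter op (Q Q' : pred (seq block)) P :
  (forall pi, Q pi -> all Q' (add_letter op pi)) -> all Q P ->
  all Q' (flatten [seq add_letter op pi | pi <- P]).
Proof.
move=> QQ'; elim: P => // pi P IH /andP[Qpi QP].
have -> : flatten [seq add_letter op pi | pi <- pi :: P] =
    add_letter op pi ++ flatten [seq add_letter op pi | pi <- P] by [].
by rewrite all_cat QQ' //= IH.
Qed.

Lemma size_partitions w w' :
  all (fun pi => size pi <= size w + size w')%N (partitions w w').
Proof.
have step op n (pi : seq block) : (size pi <= n)%N ->
    all (fun pi : seq block => size pi <= n.+1)%N (add_letter op pi).
  move=> le_n; rewrite /= ltnS le_n /=; apply: sub_all (size_alter_one op pi).
  by move=> t /eqP->; exact: leqW.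
elim: w => [|i w IH] /=; last exact: all_flatten_add_letter (step _ _) IH.
by elim: w' => //= j w' IH; exact: all_flatten_add_letter (step _ _) IH.
Qed.

Lemma partitions_nonempty w w' :
  all (all (fun u : block => ~~ (nilp u.1 && nilp u.2))) (partitions w w').
Proof.
set Q := (X in all X).
have step op (pi : seq block) :
    (forall b : block, ~~ (nilp (op b).1 && nilp (op b).2)) -> Q pi ->
    all Q (add_letter op pi).
  move=> ope Qpi; apply/andP; split; last by apply: all_alter_one Qpi.
  by apply/andP; split; first exact: ope.
elim: w => [|i w IH] /=.
  elim: w' => //= j w' IH; apply: all_flatten_add_letter IH => pi.
  by apply: step => b; rewrite andbF.
by apply: all_flatten_add_letter IH => pi; exact: step.
Qed.

Lemma size_blocks_partitions w w' :
  all (all (fun u : block => size u.1 <= size w)%N) (partitions w w').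
Proof.
have step i n (pi : seq block) : all (fun u : block => size u.1 <= n)%N pi ->
    all (all (fun u : block => size u.1 <= n.+1)%N) (add_letter (consl i) pi).
  move=> le_n; apply/andP; split; last first.
    by apply: all_alter_one le_n => b; first exact: leqW.
  by apply: sub_all le_n => b; exact: leqW.
elim: w => [|i w IH] /=; last exact: all_flatten_add_letter (step i _) IH.
elim: w' => //= j w' IH; apply: all_flatten_add_letter IH => pi le_0.
by apply/andP; split; [exact: le_0|exact: all_alter_one le_0].
Qed.

End Partitions.

Section Coproducts.
Context {A B : Type}.
Local Notation block := (seq A * seq B)%type.

Lemma sum_coprod_cons (C : Type) (U : nmodType) (i : C) w
    (f : seq C * seq C -> U) :
  \sum_(p <- coprod (i :: w)) f p =
  \sum_(p <- coprod w) (f (i :: p.1, p.2) + f (p.1, i :: p.2)).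
Proof. by rewrite /= big_cat !big_map big_split. Qed.

Lemma sum_coprod_iterS (C : Type) (U : nmodType) m (w : seq C)
    (f : seq (seq C) -> U) :
  \sum_(t <- coprod_iter m.+1 w) f t =
  \sum_(p <- coprod w) \sum_(t <- coprod_iter m p.2) f (p.1 :: t).
Proof.
rewrite /= big_flatten big_map; apply: eq_bigr => p _.
by rewrite big_map.
Qed.

(** The iterated coproduct is a morphism: a letter put in front of a word goes
    to one of the factors. *)
Lemma sum_coprod_iter_cons (C : Type) (U : nmodType) m (i : C) w
    (f : seq (seq C) -> U) :
  \sum_(t <- coprod_iter m (i :: w)) f t =
  \sum_(t <- coprod_iter m w) \sum_(t' <- alter_one (cons i) t) f t'.
Proof.
elim: m w f => [|m IH] w f.
  by rewrite big_nil /=; case: (nilp w); rewrite ?big_nil// big_seq1 big_nil.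
rewrite !sum_coprod_iterS sum_coprod_cons; apply: eq_bigr => p _ /=.
rewrite IH -big_split; apply: eq_bigr => t _ /=.
by rewrite big_cons big_map.
Qed.

Lemma coprod_iter_nil (C : Type) m :
  coprod_iter m ([::] : seq C) = [:: nseq m [::]].
Proof. by elim: m => //= m ->. Qed.

Lemma size_coprod_iter (C : Type) m (w : seq C) :
  all (fun t => size t == m) (coprod_iter m w).
Proof.
elim: m w => [|m IH] w /=; first by case: (nilp w).
elim: (coprod w) => // p s IHs /=.
by rewrite all_cat IHs andbT all_map; apply: sub_all (IH p.2) => t /=.
Qed.

Lemma sum_alter_one_zipl (U : nmodType) i (x : seq (seq A)) (y : seq (seq B))
    (f : seq block -> U) : size x = size y ->
  \sum_(t <- alter_one (cons i) x) f (zip t y) =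
  \sum_(t <- alter_one (consl i) (zip x y)) f t.
Proof.
elim: x y f => [|u x IH] [|v y] f //=; first by rewrite !big_nil.
move=> [eq_xy]; rewrite !big_cons !big_map; congr (_ + _).
exact: (IH y (fun t => f ((u, v) :: t))).
Qed.

Lemma sum_alter_one_zipr (U : nmodType) j (x : seq (seq A)) (y : seq (seq B))
    (f : seq block -> U) : size x = size y ->
  \sum_(t <- alter_one (cons j) y) f (zip x t) =
  \sum_(t <- alter_one (consr j) (zip x y)) f t.
Proof.
elim: x y f => [|u x IH] [|v y] f //=; first by rewrite !big_nil.
move=> [eq_xy]; rewrite !big_cons !big_map; congr (_ + _).
exact: (IH y (fun t => f ((u, v) :: t))).
Qed.

End Coproducts.

Lemma eq_big_all (T : Type) (U : nmodType) (P : pred T) (s : seq T)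
    (f h : T -> U) :
  all P s -> (forall x, P x -> f x = h x) ->
  \sum_(x <- s) f x = \sum_(x <- s) h x.
Proof.
move=> Ps fh; elim: s Ps => [|x s IH]; first by rewrite !big_nil.
by rewrite !big_cons => /andP[/fh-> /IH->].
Qed.

Section CoproductPartitions.
Context {A B : eqType}.
Local Notation block := (seq A * seq B)%type.

Definition empty_block : block := ([::], [::]).

Definition coprod2_sum {U : nmodType} m w w' (f : seq block -> U) :=
  \sum_(x <- coprod_iter m w) \sum_(y <- coprod_iter m w') f (zip x y).

Lemma coprod2_sum_consl (U : nmodType) m i w w' (f : seq block -> U) :
  coprod2_sum m (i :: w) w' f =
  coprod2_sum m w w' (fun s => \sum_(t <- alter_one (consl i) s) f t).
Proof.
rewrite /coprod2_sum sum_coprod_iter_cons.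
apply: (eq_big_all (size_coprod_iter m w)) => x /eqP sx.
rewrite exchange_big; apply: (eq_big_all (size_coprod_iter m w')) => y /eqP sy.
by rewrite sum_alter_one_zipl // sx sy.
Qed.

Lemma coprod2_sum_consr (U : nmodType) m j w w' (f : seq block -> U) :
  coprod2_sum m w (j :: w') f =
  coprod2_sum m w w' (fun s => \sum_(t <- alter_one (consr j) s) f t).
Proof.
apply: (eq_big_all (size_coprod_iter m w)) => x /eqP sx.
rewrite sum_coprod_iter_cons.
apply: (eq_big_all (size_coprod_iter m w')) => y /eqP sy.
by rewrite sum_alter_one_zipr // sx sy.
Qed.

(** [pi] is completed by empty slots to [m] slots; the weight counts the
    placements of its blocks. *)
Definition padded {U : nmodType} m (f : seq block -> U) (pi : seq block) : U :=
  f (pi ++ nseq (m - size pi) empty_block) *+ m ^_ (size pi).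

Lemma padded_add_letter (U : nmodType) m op (f : seq block -> U) P :
  perm_invariant f ->
  \sum_(pi <- P) padded m (fun s => \sum_(t <- alter_one op s) f t) pi =
  \sum_(pi <- flatten [seq add_letter op pi | pi <- P]) padded m f pi.
Proof.
move=> fP; rewrite big_flatten big_map; apply: eq_bigr => pi _.
rewrite /padded sum_alter_one_cat sum_alter_one_nseq // mulrnDl addrC.
rewrite -mulrnA big_cons /=; congr (_ + _).
  by rewrite ffactnSr mulnC subnS.
rewrite -sumrMnl; apply: (eq_big_all (size_alter_one op pi)) => t /eqP ->.
by [].
Qed.

(** A tensor of [m] subwords is a map from positions to [m] slots. Its nonempty
    slots are the blocks of a partition [pi], and [pi] comes from the
    [m ^_ (size pi)] injections of its blocks into the slots. *)
Lemma coprod2_sum_partitions (U : nmodType) m w w' (f : seq block -> U) :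
  perm_invariant f ->
  coprod2_sum m w w' f = \sum_(pi <- partitions w w') padded m f pi.
Proof.
elim: w f => [|i w IH] f fP /=; last first.
  rewrite coprod2_sum_consl IH; last exact: alter_one_perm.
  exact: padded_add_letter.
elim: w' f fP => [|j w' IH] f fP /=; last first.
  rewrite coprod2_sum_consr IH; last exact: alter_one_perm.
  exact: padded_add_letter.
rewrite /coprod2_sum !coprod_iter_nil !big_seq1 /padded /= subn0 ffactn0 mulr1n.
by congr f; elim: m => //= m ->.
Qed.

Lemma sum_rcoprod2_iter (U : nmodType) m w w' (f : seq block -> U) :
  \sum_(t <- rcoprod2_iter m w w') f t =
  coprod2_sum m w w' (fun t =>
    if all (fun u : block => ~~ (nilp u.1 && nilp u.2)) t then f t else 0).
Proof. by rewrite /rcoprod2_iter big_filter big_mkcond big_allpairs_dep. Qed.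

Lemma sum_rcoprod2_partitions (U : nmodType) m w w' (f : seq block -> U) :
  perm_invariant f ->
  \sum_(t <- rcoprod2_iter m w w') f t =
  \sum_(pi <- partitions w w') (if size pi == m then f pi *+ m`! else 0).
Proof.
move=> fP; rewrite sum_rcoprod2_iter coprod2_sum_partitions; last first.
  by move=> s t st; rewrite (perm_all _ st) (fP _ _ st).
apply: (eq_big_all (partitions_nonempty w w')) => pi ne_pi.
rewrite /padded all_cat ne_pi /=; case: ltngtP => [lt|gt|->].
- by rewrite all_nseq /= subn_eq0 leqNgt lt /= mul0rn.
- by rewrite ffact_small // mulr0n.
- by rewrite subnn all_nseq /= cats0 ffactnn.
Qed.

(** The reduced coproduct meets a partition into [m] blocks once for every
    ordering of the blocks, hence the weights [1 / m!]. *)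
Lemma weighted_rcoprod2_partitions (R : numFieldType) (U : lmodType R) M w w'
    (f : seq block -> U) : perm_invariant f -> (size w + size w' < M)%N ->
  \sum_(0 <= m < M) ((m`!)%:R : R)^-1 *: \sum_(t <- rcoprod2_iter m w w') f t =
  \sum_(pi <- partitions w w') f pi.
Proof.
move=> fP ltM.
under eq_bigr do rewrite sum_rcoprod2_partitions // scaler_sumr.
rewrite exchange_big /=; apply: (eq_big_all (size_partitions w w')) => pi le_pi.
rewrite big_mkord (bigD1 (Ordinal (leq_ltn_trans le_pi ltM))) //= eqxx.
rewrite -[f pi *+ _](@scaler_nat R) scalerA mulVf; last first.
  by rewrite pnatr_eq0 -lt0n fact_gt0.
rewrite scale1r.
rewrite big1 ?addr0 // => m ne_m; case: eqP => [eq_m|_];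
  last by rewrite scaler0.
by case/eqP: ne_m; apply: val_inj.
Qed.

End CoproductPartitions.

Arguments empty_block {A B}.

Lemma sum_rcoprod2_swap (A B : eqType) (U : nmodType) m (w : seq A) (w' : seq B)
    (f : seq (seq B * seq A) -> U) :
  \sum_(t <- rcoprod2_iter m w' w) f t =
  \sum_(t <- rcoprod2_iter m w w') f [seq (u.2, u.1) | u <- t].
Proof.
rewrite !sum_rcoprod2_iter /coprod2_sum exchange_big.
apply: eq_bigr => x _; apply: eq_bigr => y _.
have -> : [seq (u.2, u.1) | u <- zip x y] = zip y x.
  by elim: x y => [|? x IH] [|? y] //=; rewrite IH.
congr (if _ then _ else _).
by elim: x y => [|? x IH] [|? y] //=; rewrite IH [nilp _ && _]andbC.
Qed.

Lemma sum_partitions_swap (R : numFieldType) (A B : eqType) (U : lmodType R)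
    (w : seq A) (w' : seq B) (f : seq (seq B * seq A) -> U) :
  perm_invariant f ->
  \sum_(pi <- partitions w' w) f pi =
  \sum_(pi <- partitions w w') f [seq (u.2, u.1) | u <- pi].
Proof.
move=> fP; pose M := (size w + size w').+1.
rewrite -(@weighted_rcoprod2_partitions _ _ _ _ M) //; last by rewrite addnC.
rewrite -(@weighted_rcoprod2_partitions _ _ _ _ M) //; last first.
  by move=> s t st; apply: fP; exact: perm_map.
by apply: eq_bigr => m _; rewrite sum_rcoprod2_swap.
Qed.

(** * Finite-dimensional spaces and the mean value inequality *)

Section FiniteDimension.
Context {R : realType} {V : finBanachType R}.
Local Notation e := (vbasis (@fullv _ V)).

(** The coordinates of a finite-dimensional normed space are bounded, because
    the norm has a positive minimum on the unit sphere of the coordinates. *)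
Lemma coord_bounded : exists2 k : R, 0 < k &
  forall i (v : V), `|coord e i v| <= k * `|v|.
Proof.
pose n := \dim (@fullv _ V).
pose phi (c : 'rV[R]_n) : V := \sum_i c ord0 i *: e`_i.
have phi_cont : continuous phi.
  move=> c; apply: (@cvg_big _ _ _ _ _ add_continuous _ (nbhs c)) => i _.
  by apply: (@cvgZr_tmp _ _ _ (nbhs c) _ _ (c ord0 i)); exact: coord_continuous.
pose A := [set c : 'rV[R]_n | `|c| = 1].
have [d d_gt0 dP] : exists2 d : R, 0 < d & forall c, A c -> d <= `|phi c|.
  have [A0|A0] := pselect (A !=set0); last first.
    by exists 1 => // c Ac; case: A0; exists c.
  have cA : compact A.
    apply: bounded_closed_compact.
      exists 1; split; first exact: num_real.
      by move=> x x1 c /= ->; exact: ltW.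
    rewrite (_ : A = (fun c : 'rV[R]_n => `|c|) @^-1` [set x : R | x = 1]) //.
    apply: preimage_closed; last exact: closed_eq.

    by move=> x _; exact: norm_continuous.
  have [c cA' cP] : exists2 c, c \in A & forall t, t \in A ->
      `|phi c| <= `|phi t|.
    apply: EVT_min_rV => //; apply: continuous_subspaceT => x.
    by apply: (@continuous_comp _ _ _ phi);
      [exact: phi_cont|exact: norm_continuous].
  exists `|phi c|; last by move=> t At; apply: cP; rewrite inE.
  rewrite normr_gt0; apply/eqP => phi0.
  move: cA'; rewrite inE /A /= => c1.
  have c0 : c = 0.
    apply/rowP => i; rewrite mxE.
    have := coord_sum_free (fun i => c ord0 i) i
      (basis_free (vbasisP (@fullv _ V))).
    by rewrite -/(phi c) phi0 linear0.
  by move: c1; rewrite c0 normr0 => /eqP; rewrite eq_sym oner_eq0.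
exists d^-1; first by rewrite invr_gt0.
move=> i v; pose c : 'rV[R]_n := \row_i coord e i v.
have phic : phi c = v.
  rewrite [RHS](coord_vbasis (memvf v)); apply: eq_bigr => j _.
  by rewrite mxE.
have ci : `|coord e i v| <= `|c|.
  have -> : coord e i v = c ord0 i by rewrite mxE.
  rewrite [leRHS]/Num.norm /= mx_normrE; apply/bigmax_geP; right => /=.
  by exists (ord0, i).
have [c0|c0] := eqVneq c 0.
  move: ci; rewrite c0 normr0 => /le_trans; apply.
  by rewrite mulr_ge0 // ?invr_ge0 // ltW.
apply: (le_trans ci); have nc0 : 0 < `|c| by rewrite normr_gt0.
rewrite ler_pdivlMl // -ler_pdivlMr //.
have -> : `|v| / `|c| = `|phi (`|c|^-1 *: c)|.
  rewrite -phic /phi [in RHS](eq_bigr (fun i => `|c|^-1 *: (c ord0 i *: e`_i))).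
    by rewrite -scaler_sumr normrZ normrV ?unitfE ?normr_eq0 // normr_id mulrC.
  by move=> j _; rewrite mxE scalerA.
apply: dP; rewrite /A /= normrZ normrV ?unitfE ?normr_eq0 // normr_id.
by rewrite mulVf // normr_eq0.
Qed.

Lemma coord_continuous_fin i : continuous (coord e i).
Proof.
have [k k0 kP] := coord_bounded.
apply: (@linear_bounded_continuous _ _ _ (coord e i)).1.
apply/linear_boundedP; apply: filterS (nbhs_pinfty_ge (num_real k)) => r kr v.
by apply: (le_trans (kP i v)); apply: ler_wpM2r.
Qed.

Lemma norm_le_coord (v : V) : `|v| <= \sum_i `|coord e i v| * `|e`_i|.
Proof.
rewrite {1}(coord_vbasis (memvf v)); apply: le_trans (ler_norm_sum _ _ _) _.
by apply: ler_sum => i _; rewrite normrZ.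
Qed.

End FiniteDimension.

Section Derivative.
Context {R : realType}.

(** The derivative of a curve in the form in which it is computed below, by
    limits of difference quotients. *)
Definition derivative_at {E : normedModType R} (f : R -> E) (t : R) (d : E) :=
  h^-1 *: (f (h + t) - f t) @[h --> (0 : R)^'] --> d.

Lemma is_derive_derivative_at (E : normedModType R) (f : R -> E) (t : R) d :
  is_derive (t : R^o) 1 f d -> derivative_at f t d.
Proof.
move=> [df <-]; have : derivable f t 1 by exact: df.
rewrite /derivative_at /derive /derivable.
set g := (X in cvg (X @ _)); move=> cg.
have -> : (fun h => h^-1 *: (f (h + t) - f t)) = g.
  by apply/funext => h; rewrite /g /= [h *: 1]mulr1.
exact: cg.
Qed.

Lemma derivative_at_derive1 (f : R -> R) (t d : R) :
  derivative_at (f : R -> R^o) t d -> derivable f t 1 /\ f^`() t = d.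
Proof.
move=> fd; split; last by apply/cvg_lim => //; exact: Rhausdorff.
apply/cvg_ex; exists d; move: fd; rewrite /derivative_at.
have -> // : (fun h => h^-1 *: (f (h + t) - f t)) =
  (fun h => h^-1 *: ((f \o shift t) (h *: 1) - f t)).
by apply/funext => h; rewrite /= [h *: 1]mulr1.
Qed.

Lemma derivative_at_continuous (E : normedModType R) (f : R -> E) t d :
  derivative_at f t d -> {for t, continuous f}.
Proof.
move=> fd; apply: differentiable_continuous; apply/derivable1_diffP.
apply/cvg_ex; exists d; move: fd; rewrite /derivative_at.
have -> // : (fun h => h^-1 *: (f (h + t) - f t)) =
  (fun h => h^-1 *: ((f \o shift t) (h *: 1) - f t)).
by apply/funext => h; rewrite /= [h *: 1]mulr1.
Qed.

Lemma derivative_at_cst (E : normedModType R) (v : E) t :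
  derivative_at (fun=> v) t 0.
Proof.
rewrite /derivative_at; under eq_fun do rewrite subrr scaler0.
exact: cvg_cst.
Qed.

Lemma derivative_at_id t : derivative_at (fun x => x : R^o) t 1.
Proof. by apply: is_derive_derivative_at; exact: is_derive_id. Qed.

Lemma derivative_at_sum (I : Type) (s : seq I) (E : normedModType R)
    (f : I -> R -> E) t (d : I -> E) :
  (forall i, derivative_at (f i) t (d i)) ->
  derivative_at (fun x => \sum_(i <- s) f i x) t (\sum_(i <- s) d i).
Proof.
move=> fd; rewrite /derivative_at.
under eq_fun do rewrite -sumrB scaler_sumr.
apply: cvg_big => [|i _]; first exact: add_continuous.
exact: fd.
Qed.

Lemma derivative_atZl (E : normedModType R) (f : R -> R) t d (v : E) :
  derivative_at (f : R -> R^o) t d ->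
  derivative_at (fun x => f x *: v) t (d *: v).
Proof.
rewrite /derivative_at => fd.
under eq_fun do rewrite -scalerBl scalerA.
exact: cvgZr_tmp.
Qed.

Lemma derivative_atZ (E : normedModType R) (f : R -> E) t d (c : R) :
  derivative_at f t d -> derivative_at (fun x => c *: f x) t (c *: d).
Proof.
rewrite /derivative_at => fd.
under eq_fun do rewrite -scalerBr scalerA mulrC -scalerA.
exact: cvgZl_tmp.
Qed.

Lemma derivative_atB (E : normedModType R) (f g : R -> E) t df dg :
  derivative_at f t df -> derivative_at g t dg ->
  derivative_at (fun x => f x - g x) t (df - dg).
Proof.
rewrite /derivative_at => fd gd.
under eq_fun do rewrite opprD addrACA -opprD scalerBr.
exact: cvgB.
Qed.

Lemma derivative_at_cvg (E : normedModType R) (f : R -> E) t d :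
  derivative_at f t d -> f (h + t) @[h --> (0 : R)^'] --> f t.
Proof.
move=> fd; have : f t + h *: (h^-1 *: (f (h + t) - f t)) @[h --> (0 : R)^'] -->
    f t + 0 *: d.
  apply: cvgD; first exact: cvg_cst.
  by apply: cvgZ => //; apply: cvg_within_filter; exact: cvg_id.
rewrite scale0r addr0; apply: cvg_trans; apply: near_eq_cvg; near=> h.
have h0 : h != 0 by near: h; exact: nbhs_dnbhs_neq.
by rewrite scalerA mulfV // scale1r addrC subrK.
Unshelve. all: by end_near. Qed.

Lemma derivative_at_coord (V : finBanachType R) (f : R -> V) t d i :
  derivative_at f t d ->
  derivative_at (fun x => coord (vbasis fullv) i (f x) : R^o) t
    (coord (vbasis fullv) i d).
Proof.
rewrite /derivative_at => fd.
under eq_fun do rewrite -linearB -[_ *: _]linearZ.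
apply: (cvg_comp _ _ fd); exact: coord_continuous_fin.
Qed.

(** The mean value inequality. The constant compares the norm with the
    coordinates, to which the scalar mean value theorem applies. *)
Lemma mean_value_inequality (V : finBanachType R) : exists2 c : R, 0 <= c &
  forall (f f' : R -> V) (phi phi' : R -> R) a b, a <= b ->
    {within `[a, b], continuous f} -> {within `[a, b], continuous phi} ->
    (forall t, a < t < b -> derivative_at f t (f' t)) ->
    (forall t, a < t < b -> derivative_at (phi : R -> R^o) t (phi' t)) ->
    (forall t, a < t < b -> `|f' t| <= phi' t) ->
    `|f b - f a| <= c * (phi b - phi a).
Proof.
have [k k0 kP] := @coord_bounded R V.
pose e := vbasis (@fullv _ V).
exists (k * \sum_(i < \dim (@fullv _ V)) `|e`_i|).
  by rewrite mulr_ge0 ?(ltW k0) ?sumr_ge0.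
move=> f f' phi phi' a b le_ab fc phic fd phid bound.
have half (s : R) i : `|s| = 1 -> 
    s * coord e i (f b - f a) <= k * (phi b - phi a).
  move=> s1; pose psi x : R := k * phi x - s * coord e i (f x).
  have psid t : a < t < b ->
      derivative_at (psi : R -> R^o) t (k * phi' t - s * coord e i (f' t)).
    move=> tab; apply: derivative_atB.
    - by apply: (@derivative_atZ R^o); exact: phid.
    - apply: (@derivative_atZ R^o).
      by apply: derivative_at_coord; exact: fd.
  have psic : {within `[a, b], continuous psi}.
    move=> x; apply: cvgB; apply: cvgM; try exact: cvg_cst; first exact: phic.
    apply: (cvg_comp _ _ (fc x)); exact: coord_continuous_fin.
  have : psi a <= psi b.
    apply: (ger0_derive1_le_cc _ _ psic) => //;
      rewrite ?in_itv /= ?lexx ?le_ab //.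
    - by move=> x; rewrite in_itv /= => /psid/derivative_at_derive1[].
    - move=> x; rewrite in_itv /= => xab.
      have [_ ->] := derivative_at_derive1 (psid _ xab).
      rewrite subr_ge0; apply: le_trans (ler_norm _) _.
      rewrite normrM s1 mul1r; apply: le_trans (kP _ _) _.
      by rewrite ler_pM2l // bound.
  rewrite /psi linearB; lra.
apply: le_trans (norm_le_coord _) _.
rewrite mulrAC mulr_sumr ler_sum // => i _; apply: ler_wpM2r => //.
rewrite ler_norml; apply/andP; split.
  by have := half (-1) i; rewrite normrN normr1 => /(_ erefl); lra.
by have := half 1 i; rewrite normr1 => /(_ erefl); lra.
Qed.

End Derivative.

(** * Symmetric higher derivatives *)

Lemma ler0_of_small (R : realFieldType) (x C : R) :
  (forall e, 0 < e -> x <= e * C) -> x <= 0.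
Proof.
move=> xC; rewrite leNgt; apply/negP => x0.
have C1 : 0 < `|C| + 1 by rewrite ltr_wpDl.
have := xC (x / (2 * (`|C| + 1))); rewrite divr_gt0 ?mulr_gt0 // => /(_ erefl).
rewrite -mulrA leNgt gtr_pMr //; apply/negP/negPn.
rewrite ltr_pdivrMl ?mulr_gt0 // mulr1.
by apply: le_lt_trans (ler_norm C) _; lra.
Qed.

Lemma subr_shuffle (U : zmodType) (a b d x y : U) :
  a - b - x = (a - d - (x + y)) - (b - d - y).
Proof.
have -> : b - d - y = b - (d + y) by rewrite opprD addrA.
have -> : a - d - (x + y) = a - x - (d + y).
  by rewrite !opprD !addrA [a - d - x]addrAC.
by rewrite opprB addrA subrK addrAC.
Qed.

Section Multilinear.
Context {R : realType} {F S : normedModType R}.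

Definition multilinear (M : seq F -> S) := forall s1 s2 (a : R) u v,
  M (s1 ++ (a *: u + v) :: s2) = a *: M (s1 ++ u :: s2) + M (s1 ++ v :: s2).

Definition multibounded (M : seq F -> S) := forall m : nat,
  exists2 C : R, 0 <= C &
    forall s, size s = m -> `|M s| <= C * \prod_(v <- s) `|v|.

Lemma multilinear_cons M v : multilinear M -> multilinear (fun s => M (v :: s)).
Proof. by move=> ML s1 s2 a x y; exact: (ML (v :: s1)). Qed.

Lemma multibounded_cons M v :
  multibounded M -> multibounded (fun s => M (v :: s)).
Proof.
move=> MB m; have [C C0 CP] := MB m.+1.
exists (C * `|v|); first exact: mulr_ge0.
move=> s sm; apply: le_trans (CP _ _) _; first by rewrite /= sm.
by rewrite big_cons mulrA.
Qed.

Section MultilinearTheory.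
Variable M : seq F -> S.
Hypotheses (ML : multilinear M).

Lemma multilinearD s1 s2 u v :
  M (s1 ++ (u + v) :: s2) = M (s1 ++ u :: s2) + M (s1 ++ v :: s2).
Proof. by have := ML s1 s2 1 u v; rewrite !scale1r. Qed.

Lemma multilinear0 s1 s2 : M (s1 ++ 0 :: s2) = 0.
Proof.
have := multilinearD s1 s2 0 0; rewrite addr0 => /esym/eqP.
by rewrite -subr_eq0 addrK => /eqP.
Qed.

Lemma multilinearZ s1 s2 a u :
  M (s1 ++ (a *: u) :: s2) = a *: M (s1 ++ u :: s2).
Proof. by have := ML s1 s2 a u 0; rewrite addr0 multilinear0 addr0. Qed.

Lemma multilinearB s1 s2 u v :
  M (s1 ++ (u - v) :: s2) = M (s1 ++ u :: s2) - M (s1 ++ v :: s2).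
Proof. by rewrite multilinearD -scaleN1r multilinearZ scaleN1r. Qed.

Lemma multilinear_sum (I : Type) (r : seq I) s1 s2 (u : I -> F) :
  M (s1 ++ (\sum_(i <- r) u i) :: s2) = \sum_(i <- r) M (s1 ++ u i :: s2).
Proof.
elim: r => [|i r IH]; first by rewrite !big_nil multilinear0.
by rewrite !big_cons multilinearD IH.
Qed.

End MultilinearTheory.

Lemma cvg_prod_norm {T B : Type} (Fl : set_system T) {FF : Filter Fl}
    (zeta : T -> B -> F) (zeta0 : B -> F) (pi : seq B) :
  (forall b, zeta x b @[x --> Fl] --> zeta0 b) ->
  \prod_(b <- pi) `|zeta x b| @[x --> Fl] --> \prod_(b <- pi) `|zeta0 b|.
Proof.
move=> zc; apply: (@cvg_big _ _ _ _ _ mul_continuous) => b _.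
exact: cvg_norm.
Qed.

Lemma multilinear_cvg {T B : Type} (Fl : set_system T) {FF : Filter Fl} M
    (zeta : T -> B -> F) (zeta0 : B -> F) (pi : seq B) :
  multilinear M -> multibounded M ->
  (forall b, zeta x b @[x --> Fl] --> zeta0 b) ->
  M [seq zeta x b | b <- pi] @[x --> Fl] --> M [seq zeta0 b | b <- pi].
Proof.
move=> + + zc; elim: pi M => [|b pi IH] M ML MB /=; first exact: cvg_cst.
rewrite -[X in _ --> X]add0r.
have -> : (fun x => M (zeta x b :: [seq zeta x b0 | b0 <- pi])) = (fun x =>
   M ((zeta x b - zeta0 b) :: [seq zeta x b0 | b0 <- pi]) +
   M (zeta0 b :: [seq zeta x b0 | b0 <- pi])).
  apply/funext => x.
  by rewrite -(multilinearD ML [::]) subrK.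
apply: cvgD; last first.
  by apply: (IH (fun s => M (zeta0 b :: s)));
    [exact: multilinear_cons|exact: multibounded_cons].
have [C C0 CP] := MB (size pi).+1.
apply/norm_cvg0P; apply: (@squeeze_cvgr _ _ _ _ (fun=> 0)
    (fun x => C * (`|zeta x b - zeta0 b| * \prod_(b <- pi) `|zeta x b|))).
- near=> x; rewrite normr_ge0 /=; apply: le_trans (CP _ _) _.
    by rewrite /= size_map.
  by rewrite big_cons big_map.
- exact: cvg_cst.
- rewrite -[X in _ --> X](mulr0 C); apply: cvgMr.
  rewrite -[X in _ --> X](mul0r (\prod_(b <- pi) `|zeta0 b|)).
  apply: cvgM; last exact: cvg_prod_norm.
  by rewrite -(normr0 F) -(subrr (zeta0 b)); apply: cvg_norm; apply: cvgB => //;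
    exact: cvg_cst.
Unshelve. all: by end_near. Qed.

Fixpoint replace_one {B : Type} (f f' : B -> F) (pi : seq B) : seq (seq F) :=
  if pi is b :: pi' then
    (f' b :: [seq f b | b <- pi']) ::
    [seq f b :: s | s <- replace_one f f' pi']
  else [::].

Lemma multilinear_derivative {B : Type} M (zeta : R -> B -> F) t zeta'
    (pi : seq B) :
  multilinear M -> multibounded M ->
  (forall b, derivative_at (zeta^~ b) t (zeta' b)) ->
  derivative_at (fun x => M [seq zeta x b | b <- pi]) t
    (\sum_(s <- replace_one (zeta t) zeta' pi) M s).
Proof.
move=> + + zd; elim: pi M => [|b pi IH] M ML MB /=.
  by rewrite big_nil; exact: derivative_at_cst.
rewrite big_cons big_map /derivative_at.
have -> : (fun h => h^-1 *:
    (M (zeta (h + t) b :: [seq zeta (h + t) b | b <- pi]) -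
     M (zeta t b :: [seq zeta t b | b <- pi]))) = (fun h =>
   M ((h^-1 *: (zeta (h + t) b - zeta t b)) :: [seq zeta (h + t) b | b <- pi]) +
   h^-1 *: (M (zeta t b :: [seq zeta (h + t) b | b <- pi]) -
     M (zeta t b :: [seq zeta t b | b <- pi]))).
  apply/funext => h; rewrite (multilinearZ ML [::]) (multilinearB ML [::]) /=.
  by rewrite -scalerDr addrA subrK.
apply: cvgD; last first.
  by apply: (IH (fun s => M (zeta t b :: s)));
    [exact: multilinear_cons|exact: multibounded_cons].
pose eta h (o : option B) := if o is Some b then zeta (h + t) b
  else h^-1 *: (zeta (h + t) b - zeta t b).
pose eta0 (o : option B) := if o is Some b then zeta t b else zeta' b.
have := @multilinear_cvg _ _ (0 : R)^' _ M eta eta0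
  (None :: [seq Some b | b <- pi]) ML MB.
rewrite /= -!map_comp; under eq_fun do rewrite /= -map_comp.
apply; case=> [b'|] /=; first exact: derivative_at_cvg (zd b').
exact: zd.
Qed.

End Multilinear.

Section Frechet.
Context {R : realType} {F : normedModType R} {S : finBanachType R}.
Variable g : F -> S.
Hypothesis g_smooth : frechet_smooth g.
Local Notation prodn vs := (\prod_(v <- vs) `|v|).

Lemma frechet_headP (a : R) u v vs x :
  frechet g ((a *: u + v) :: vs) x =
  a *: frechet g (u :: vs) x + frechet g (v :: vs) x.
Proof. by rewrite /= linearP. Qed.

Lemma frechet_headD u v vs x :
  frechet g ((u + v) :: vs) x = frechet g (u :: vs) x + frechet g (v :: vs) x.
Proof. by rewrite /= linearD. Qed.

Lemma frechet_headZ (a : R) u vs x :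
  frechet g ((a *: u) :: vs) x = a *: frechet g (u :: vs) x.
Proof. by rewrite /= linearZ. Qed.

Lemma frechet_head_sum (I : Type) (r : seq I) (a : I -> R) (u : I -> F) vs x :
  frechet g ((\sum_(i <- r) a i *: u i) :: vs) x =
  \sum_(i <- r) a i *: frechet g (u i :: vs) x.
Proof.
elim: r => [|i r IH]; first by rewrite !big_nil /= linear0.
by rewrite !big_cons frechet_headP IH.
Qed.

Lemma prodn_ge0 (vs : seq F) : 0 <= prodn vs.
Proof. by apply: prodr_ge0. Qed.

Lemma frechet_bounded x m : exists2 C : R, 0 <= C &
  forall vs, size vs = m -> `|frechet g vs x| <= C * prodn vs.
Proof.
have [[C CP] _] := g_smooth m x; exists `|C| => // vs sm.
apply: le_trans (CP _ sm) _; apply: ler_wpM2r (ler_norm _).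
exact: prodn_ge0.
Qed.

Lemma frechet_expand x m (e : R) : 0 < e -> exists2 d : R, 0 < d &
  forall h vs, `|h| < d -> size vs = m ->
  `|frechet g vs (x + h) - frechet g vs x - frechet g (h :: vs) x| <=
    e * `|h| * prodn vs.
Proof.
move=> e0; have [_ /(_ e e0)/nbhs_norm0P[d /= d0 dP]] := g_smooth m x.
by exists d => // h vs hd; apply: dP.
Qed.

Lemma frechet_near x m : exists2 C : R, 0 <= C & exists2 d : R, 0 < d &
  forall h vs, `|h| < d -> size vs = m ->
  `|frechet g vs (x + h) - frechet g vs x| <= C * `|h| * prodn vs.
Proof.
have [C C0 CP] := frechet_bounded x m.+1.
have [d d0 dP] := frechet_expand x m ltr01.
exists (1 + C); first by rewrite addr_ge0.
exists d => // h vs hd sm.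
rewrite -[X in `|X|](subrK (frechet g (h :: vs) x)).
apply: le_trans (ler_normD _ _) _; rewrite mulrDl mulrDl.
apply: lerD; first exact: dP.
by apply: le_trans (CP _ _) _; rewrite /= ?sm // big_cons mulrA.
Qed.

Lemma frechet_line_derivative x v vs t :
  derivative_at (fun s => frechet g vs (x + s *: v)) t
    (frechet g (v :: vs) (x + t *: v)).
Proof.
apply/cvgrPdist_le => e e0 /=.
pose P := `|v| * prodn vs.
have P0 : 0 <= P by rewrite mulr_ge0 ?prodn_ge0.
have e'0 : 0 < e / (P + 1) by rewrite divr_gt0 // ltr_wpDl.
have [d d0 dP] := frechet_expand (x + t *: v) (size vs) e'0.
near=> h.
have h0 : h != 0 by near: h; exact: nbhs_dnbhs_neq.
have := dP (h *: v) vs _ erefl; rewrite frechet_headZ.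
have -> : x + t *: v + h *: v = x + (h + t) *: v.
  by rewrite scalerDl -addrA (addrC (h *: v)).
have hv : `|h *: v| < d.
  rewrite normrZ; apply: (@le_lt_trans _ _ (`|h| * (`|v| + 1))).
    by apply: ler_wpM2l => //; rewrite lerDl.
  rewrite -ltr_pdivlMr ?ltr_wpDl //.
  by near: h; apply: dnbhs0_lt; rewrite divr_gt0 // ltr_wpDl.
move=> /(_ hv) dPh; rewrite distrC.
move: (frechet g vs _ - frechet g vs _) dPh => D dPh.
have -> : h^-1 *: D - frechet g (v :: vs) (x + t *: v) =
   h^-1 *: (D - h *: frechet g (v :: vs) (x + t *: v)).
  by rewrite scalerBr scalerA mulVf // scale1r.
rewrite normrZ normfV ler_pdivrMl ?normr_gt0 //.
apply: le_trans dPh _; rewrite normrZ.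
have -> : e / (P + 1) * (`|h| * `|v|) * prodn vs = `|h| * (e / (P + 1) * P).
  by rewrite /P; ring.
apply: ler_wpM2l => //; rewrite mulrAC ler_pdivrMr ?ltr_wpDl //.
by rewrite mulrDr mulr1 lerDl ltW.
Unshelve. all: by end_near. Qed.

(** The second difference along [t *: u] and [t *: v] is symmetric in [u] and
    [v], and the mean value inequality along [u] compares it with the second
    derivative; this is the proof of the symmetry of second derivatives. *)
Lemma second_difference x u v vs : exists C : R, forall e : R, 0 < e ->
  exists2 d : R, 0 < d & forall t, 0 < t < d ->
  `|frechet g vs (x + t *: u + t *: v) - frechet g vs (x + t *: u)
    - frechet g vs (x + t *: v) + frechet g vs x
    - t ^+ 2 *: frechet g (v :: u :: vs) x| <= e * C * t ^+ 2.
Proof.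
have [c c0 mvi] := @mean_value_inequality R S.
pose P := prodn (u :: vs); have P0 : 0 <= P by exact: prodn_ge0.
pose Q := `|u| + `|v| + `|u|; have Q0 : 0 <= Q by rewrite !addr_ge0.
exists (c * (Q * P)) => e e0.
have [d d0 dP] := frechet_expand x (size vs).+1 e0.
exists (d / (Q + 1)); first by rewrite divr_gt0 // ltr_wpDl.
move=> t /andP[t0 td].
have tQ : t * Q < d.
  move: td; rewrite ltr_pdivlMr ?ltr_wpDl // mulrDr mulr1; lra.
pose f (s : R) : S :=
  frechet g vs (x + t *: v + s *: u) - frechet g vs (x + s *: u)
  - s *: (t *: frechet g (v :: u :: vs) x).
pose f' s : S := frechet g (u :: vs) (x + t *: v + s *: u)
  - frechet g (u :: vs) (x + s *: u) - t *: frechet g (v :: u :: vs) x.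
have fd s : derivative_at f s (f' s).
  apply: derivative_atB.
    by apply: derivative_atB; exact: frechet_line_derivative.
  rewrite -[X in derivative_at _ _ X]scale1r.
  by apply: derivative_atZl; exact: derivative_at_id.
have f'P s : 0 < s < t -> `|f' s| <= e * (t * Q) * P.
  move=> /andP[s0 st].
  have su : `|s *: u| <= t * `|u|.
    by rewrite normrZ gtr0_norm // ler_wpM2r // ltW.
  have tvsu : `|t *: v + s *: u| <= t * (`|u| + `|v|).
    apply: le_trans (ler_normD _ _) _; rewrite normrZ gtr0_norm //.
    by rewrite mulrDr addrC lerD2r.
  have nv : 0 <= t * `|v| by rewrite mulr_ge0 // ltW.
  have nu : 0 <= t * `|u| by rewrite mulr_ge0 // ltW.
  move: tQ; rewrite /Q !mulrDr => tQ.
  have l1 := dP (s *: u) (u :: vs) (le_lt_trans su _) erefl.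
  have l2 := dP (t *: v + s *: u) (u :: vs) (le_lt_trans tvsu _) erefl.
  have -> : f' s = (frechet g (u :: vs) (x + (t *: v + s *: u)) -
      frechet g (u :: vs) x - frechet g ((t *: v + s *: u) :: u :: vs) x) -
    (frechet g (u :: vs) (x + s *: u) - frechet g (u :: vs) x -
       frechet g ((s *: u) :: u :: vs) x).
    rewrite frechet_headD !frechet_headZ addrA /f'.
    exact: subr_shuffle.
  apply: le_trans (ler_normB _ _) _.
  apply: le_trans (lerD (l2 _) (l1 _)) _; try lra.
  rewrite -mulrDl -[X in X * _]mulrDr; apply: ler_wpM2r => //.
  rewrite -!mulrDr; apply: ler_wpM2l; first exact: ltW.
  by move: tvsu; rewrite /Q !mulrDr; lra.
have := mvi f f' (fun s => e * (t * Q) * P * s) (fun s => e * (t * Q) * P) 0 t.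
have -> : f t - f 0 =
    frechet g vs (x + t *: u + t *: v) - frechet g vs (x + t *: u)
    - frechet g vs (x + t *: v) + frechet g vs x
    - t ^+ 2 *: frechet g (v :: u :: vs) x.
  rewrite /f !scale0r !addr0 subr0 scalerA -expr2 [x + t *: v + _]addrAC.
  rewrite opprB addrAC [frechet g vs x - _]addrC addrA.
  by rewrite [RHS]addrAC; congr (_ + _); exact: addrAC.
rewrite mulr0 subr0.
have -> : c * (e * (t * Q) * P * t) = e * (c * (Q * P)) * t ^+ 2 by ring.
apply => //; first exact: ltW.
- by apply: continuous_subspaceT => s; exact: derivative_at_continuous (fd s).
- by apply: continuous_subspaceT => s; apply: cvgMr; exact: cvg_id.
- move=> s _; rewrite -[X in derivative_at _ _ X]mulr1.
  by apply: (@derivative_atZ R R^o); exact: derivative_at_id.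
Qed.

Lemma frechet_swap u v vs x :
  frechet g (u :: v :: vs) x = frechet g (v :: u :: vs) x.
Proof.
have [C1 P1] := second_difference x u v vs.
have [C2 P2] := second_difference x v u vs.
apply/eqP; rewrite -subr_eq0 -normr_le0;
  apply/(@ler0_of_small _ _ (C1 + C2)) => e e0.
have [d1 d10 {}P1] := P1 e e0; have [d2 d20 {}P2] := P2 e e0.
pose t := Num.min d1 d2 / 2.
have t0 : 0 < t by rewrite divr_gt0 // lt_min d10.
have tlt : t < Num.min d1 d2.
  by rewrite gtr_pMr ?lt_min ?d10 // invf_lt1 // ltr1n.
move: tlt; rewrite lt_min => /andP[td1 td2].
have {}P1 := P1 t; have {}P2 := P2 t.
move: P1 P2; rewrite t0 td1 td2 => /(_ erefl) P1 /(_ erefl) P2.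
have t20 : 0 < t ^+ 2 by rewrite exprn_gt0.
rewrite -(ler_pM2l t20) -{1}(gtr0_norm t20) -normrZ.
have -> : t ^+ 2 * (e * (C1 + C2)) = e * C1 * t ^+ 2 + e * C2 * t ^+ 2 by ring.
apply: le_trans _ (lerD P1 P2); apply: le_trans _ (ler_normB _ _).
rewrite scalerBr [x + t *: v + _]addrAC.
set A := frechet g vs (x + t *: u + t *: v); set D := frechet g vs x.
set B := frechet g vs (x + t *: u); set B' := frechet g vs (x + t *: v).
by rewrite [A - B' - B]addrAC opprB [X in _ <= `|X|]addrC addrA subrK.
Qed.

Lemma frechet_perm us vs : perm_eq us vs -> frechet g us = frechet g vs.
Proof.
elim: us vs => [|u us IH] vs uvs.
  by have /perm_nilP -> : perm_eq vs [::] by rewrite perm_sym.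
have vs_u : u \in vs by rewrite -(perm_mem uvs) mem_head.
case/path.splitPr: vs_u uvs => vs1 vs2 uvs.
have -> : frechet g (u :: us) = frechet g (u :: vs1 ++ vs2).
  suff /IH eq_us : perm_eq us (vs1 ++ vs2) by apply/funext => x;
    rewrite /= eq_us.
  by rewrite -(perm_cons u) (perm_trans uvs) // -cat1s perm_catCA.
elim: vs1 {uvs} => //= v vs1 IHv; rewrite -IHv; apply/funext => x.
exact: (frechet_swap u v).
Qed.

Lemma frechet_multilinear x : multilinear (fun vs => frechet g vs x).
Proof.
have move_head s1 s2 w : frechet g (s1 ++ w :: s2) = frechet g (w :: s1 ++ s2).
  by apply: frechet_perm; rewrite -cat1s perm_catCA.
by move=> s1 s2 a u v; rewrite !move_head frechet_headP.
Qed.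

Lemma frechet_multibounded x : multibounded (fun vs => frechet g vs x).
Proof. by move=> m; exact: frechet_bounded. Qed.

(** In infinite dimension a continuous derivative need not be bounded on bounded
    sets; each point has a neighbourhood on which it is, and finitely many of
    them cover [K]. *)
Lemma frechet_bounded_compact (K : set F) m : compact K ->
  exists2 C : R, 0 <= C & forall x vs, K x -> size vs = m ->
    `|frechet g vs x| <= C * prodn vs.
Proof.
move=> /compact_near_coveringP Kc.
have [] := Kc R +oo (fun C x => forall vs, size vs = m ->
    `|frechet g vs x| <= C * prodn vs) _.
- move=> x _; have [C0 C00 P0] := frechet_bounded x m.
  have [C1 C10 [d d0 P1]] := frechet_near x m.
  exists (ball x (Num.min d 1), [set C | C0 + C1 <= C]).
    split; first by apply: nbhsx_ballx; rewrite lt_min d0 /=.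
    by apply: nbhs_pinfty_ge; exact: num_real.
  move=> [x' C] /= []; rewrite -ball_normE /= distrC lt_min.
  move=> /andP[xd x1] CC vs sm.
  have -> : x' = x + (x' - x) by rewrite addrC subrK.
  rewrite -[X in `|X|](subrK (frechet g vs x)).
  apply: le_trans (ler_normD _ _) _.
  apply: (le_trans (lerD (P1 _ _ xd sm) (P0 _ sm))).
  rewrite -mulrDl; apply: ler_wpM2r; first exact: prodn_ge0.
  apply: le_trans _ CC; rewrite addrC lerD2l.
  by rewrite ler_piMr // ltW.
- move=> C [_ CP]; exists (`|C| + 1); first by rewrite addr_ge0.
  move=> x vs Kx sm; apply: (CP (`|C| + 1)) => //.
  by apply: le_lt_trans (ler_norm C) _; rewrite ltrDl.
Qed.

Lemma frechet_cvg {T B : Type} (Fl : set_system T) {FF : Filter Fl}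
    (zeta : T -> B -> F) (zeta0 : B -> F) (x : T -> F) x0 (pi : seq B) :
  (forall b, zeta t b @[t --> Fl] --> zeta0 b) -> x t @[t --> Fl] --> x0 ->
  frechet g [seq zeta t b | b <- pi] (x t) @[t --> Fl] -->
  frechet g [seq zeta0 b | b <- pi] x0.
Proof.
move=> zc xc; rewrite -[X in _ --> X]addr0.
have -> : (fun t => frechet g [seq zeta t b | b <- pi] (x t)) = (fun t =>
    frechet g [seq zeta t b | b <- pi] x0 +
    (frechet g [seq zeta t b | b <- pi] (x t) -
     frechet g [seq zeta t b | b <- pi] x0)).
  by apply/funext => t; rewrite addrC subrK.
apply: cvgD.
  exact: (multilinear_cvg (frechet_multilinear x0) (frechet_multibounded x0)).
have [C C0 [d d0 CP]] := frechet_near x0 (size pi).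
have xc0 : `|x t - x0| @[t --> Fl] --> (0 : R).
  by rewrite -(normr0 F) -(subrr x0); apply: cvg_norm; apply: cvgB => //;
    exact: cvg_cst.
apply/norm_cvg0P; apply: (@squeeze_cvgr _ _ _ _ (fun=> 0)
    (fun t => C * (`|x t - x0| * \prod_(b <- pi) `|zeta t b|))).
- near=> t; rewrite normr_ge0 /=.
  have xd : `|x t - x0| < d.
    near: t; have /cvgrPdist_lt/(_ d d0) := xc; apply: filterS => t.
    by rewrite distrC.
  have := CP (x t - x0) [seq zeta t b | b <- pi] xd.
  rewrite size_map => /(_ erefl); rewrite [x0 + _]addrC subrK big_map.
  by rewrite mulrA.
- exact: cvg_cst.
- rewrite -[X in _ --> X](mulr0 C); apply: cvgMr.
  rewrite -[X in _ --> X](mul0r (\prod_(b <- pi) `|zeta0 b|)).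
  by apply: cvgM => //; exact: cvg_prod_norm.
Unshelve. all: by end_near. Qed.

(** The variation of the base point is handled by the expansion of the
    derivative of order [size pi], which is uniform in the entries and hence
    allows them to vary at the same time; the rest is the Leibniz rule at a
    fixed base point. *)
Lemma frechet_derivative {B : Type} (zeta : R -> B -> F) (x : R -> F) t
    (zeta' : B -> F) x' (pi : seq B) :
  (forall b, derivative_at (zeta^~ b) t (zeta' b)) -> derivative_at x t x' ->
  derivative_at (fun s => frechet g [seq zeta s b | b <- pi] (x s)) t
    (frechet g (x' :: [seq zeta t b | b <- pi]) (x t) +
     \sum_(s <- replace_one (zeta t) zeta' pi) frechet g s (x t)).
Proof.
move=> zd xd.
have ML := frechet_multilinear (x t); have MB := frechet_multibounded (x t).
have zc b := derivative_at_cvg (zd b); have xc := derivative_at_cvg xd.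
rewrite /derivative_at -[X in _ --> X]add0r.
pose rest h := frechet g [seq zeta (h + t) b | b <- pi] (x (h + t)) -
  frechet g [seq zeta (h + t) b | b <- pi] (x t) -
  frechet g ((x (h + t) - x t) :: [seq zeta (h + t) b | b <- pi]) (x t).
have -> : (fun h => h^-1 *:
   (frechet g [seq zeta (h + t) b | b <- pi] (x (h + t)) -
    frechet g [seq zeta t b | b <- pi] (x t))) = (fun h =>
    h^-1 *: rest h +
    (frechet g ((h^-1 *: (x (h + t) - x t)) ::
       [seq zeta (h + t) b | b <- pi]) (x t) +
     h^-1 *: (frechet g [seq zeta (h + t) b | b <- pi] (x t) -
      frechet g [seq zeta t b | b <- pi] (x t)))).
  apply/funext => h; rewrite frechet_headZ -!scalerDr /rest.
  by rewrite !addrA !subrK.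
apply: cvgD; last apply: cvgD; last first.
- exact: (multilinear_derivative ML MB zd).
- pose eta h (o : option B) := if o is Some b then zeta (h + t) b
    else h^-1 *: (x (h + t) - x t).
  pose eta0 (o : option B) := if o is Some b then zeta t b else x'.
  have := @multilinear_cvg _ _ _ _ _ (0 : R)^' _ _ eta eta0
    (None :: [seq Some b | b <- pi]) ML MB.
  rewrite /= -!map_comp; under eq_fun do rewrite /= -map_comp.
  by apply; case=> [b'|] /=; [exact: zc|exact: xd].
pose L := `|x'| * \prod_(b <- pi) `|zeta t b|.
have L0 : 0 <= L by rewrite mulr_ge0 ?prodr_ge0.
have Lc : `|h^-1 *: (x (h + t) - x t)| * \prod_(b <- pi) `|zeta (h + t) b|
    @[h --> (0 : R)^'] --> L.
  by apply: cvgM; [exact: cvg_norm|exact: cvg_prod_norm].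
apply/cvgrPdist_le => e e0 /=.
have e'0 : 0 < e / (L + 1) by rewrite divr_gt0 // ltr_wpDl.
have [d d0 dP] := frechet_expand (x t) (size pi) e'0.
near=> h; rewrite sub0r normrN normrZ.
have h0 : h != 0 by near: h; exact: nbhs_dnbhs_neq.
have xd' : `|x (h + t) - x t| < d.
  near: h; have /cvgrPdist_lt/(_ d d0) := xc; apply: filterS => h.
  by rewrite distrC.
have Lh :
    `|h^-1 *: (x (h + t) - x t)| * \prod_(b <- pi) `|zeta (h + t) b| <= L + 1.
  near: h; have /cvgrPdist_le/(_ 1 ltr01) := Lc; apply: filterS => h.
  by rewrite ler_distlC => /andP[].
have := dP _ [seq zeta (h + t) b | b <- pi] xd'.
rewrite size_map => /(_ erefl); rewrite [x t + _]addrC subrK big_map -/(rest h).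
move=> restP; rewrite normfV ler_pdivrMl ?normr_gt0 //.
apply: le_trans restP _.
have -> : x (h + t) - x t = h *: (h^-1 *: (x (h + t) - x t)).
  by rewrite scalerA mulfV // scale1r.
rewrite normrZ.
set p := \prod_(b <- pi) _ in Lh *; set y := `|_ *: _| in Lh *.
have -> : e / (L + 1) * (`|h| * y) * p = `|h| * (e / (L + 1) * (y * p)) by ring.
apply: ler_wpM2l => //; rewrite mulrAC ler_pdivrMr ?ltr_wpDl //.
by rewrite ler_pM2l.
Unshelve. all: by end_near. Qed.

End Frechet.

(** * Pairings of truncated tensors with functions of words *)

Section Words.
Context {R : realType} {V : finBanachType R}.
Local Notation e := (vbasis (@fullv _ V)).

Lemma wseq_inj N : injective (@wseq R V N).
Proof. by move=> u v uv; apply: val_inj; apply: val_inj. Qed.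

Lemma size_wseq N (u : word V N) : (size (wseq u) < N)%N.
Proof. exact: (svalP u). Qed.

Lemma word_of_seq N (w : seq (letter V)) : (size w < N)%N ->
  exists u : word V N, wseq u = w.
Proof.
move=> wN; have wN' : (size w <= N)%N by exact: ltnW.
by exists (exist _ (Bseq wN') wN).
Qed.

Lemma coef_wseq N (x : tens R V N) u : coef x (wseq u) = x u.
Proof.
by rewrite /coef (big_pred1 u) // => v; rewrite /= (inj_eq (@wseq_inj N)).
Qed.

Lemma coef_long N (x : tens R V N) w : (N <= size w)%N -> coef x w = 0.
Proof.
move=> Nw; rewrite /coef big_pred0 // => u; apply/eqP => uw.
by move: (size_wseq u); rewrite uw ltnNge Nw.
Qed.

Lemma tword_long N w : (N <= size w)%N -> tword w = 0 :> tens R V N.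
Proof.
move=> Nw; apply/ffunP => u; rewrite !ffunE; case: eqP => // uw.
by move: (size_wseq u); rewrite uw ltnNge Nw.
Qed.

Lemma coef_tword N (w w' : seq (letter V)) : (size w < N)%N ->
  coef (tword w : tens R V N) w' = (w' == w)%:R.
Proof.
move=> wN; have [w'N|Nw'] := ltnP (size w') N.
  by have [u <-] := word_of_seq w'N; rewrite coef_wseq ffunE.
rewrite coef_long //; case: eqP => // ww'.
by move: wN; rewrite -ww' ltnNge Nw'.
Qed.

Lemma tens_basis N (x : tens R V N) : x = \sum_u (x u : R) *: tword (wseq u).
Proof.
apply/ffunP => v; rewrite sum_ffunE (bigD1 v) //= !ffunE eqxx [_ *: _]mulr1.
rewrite big1 ?addr0 // => u uv; rewrite !ffunE (inj_eq (@wseq_inj N)).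
by rewrite eq_sym (negbTE uv) scaler0.
Qed.

Lemma coefD N (x y : tens R V N) w : coef (x + y) w = coef x w + coef y w.
Proof. by rewrite /coef -big_split; apply: eq_bigr => u _; rewrite ffunE. Qed.

Lemma coefZ N (a : R) (x : tens R V N) w : coef (a *: x) w = a * coef x w.
Proof. by rewrite /coef mulr_sumr; apply: eq_bigr => u _; rewrite ffunE. Qed.

Lemma coef_sum N (I : Type) (r : seq I) (x : I -> tens R V N) w :
  coef (\sum_(i <- r) x i) w = \sum_(i <- r) coef (x i) w.
Proof.
elim: r => [|i r IH]; last by rewrite !big_cons coefD IH.
by rewrite !big_nil /coef big1 // => u _; rewrite ffunE.
Qed.

Lemma tmul_suml N (I : Type) (r : seq I) (a : I -> R) (x : I -> tens R V N) y :
  tmul (\sum_(i <- r) a i *: x i) y = \sum_(i <- r) a i *: tmul (x i) y.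
Proof.
apply/ffunP => u; rewrite sum_ffunE ffunE.
under eq_bigr do rewrite coef_sum mulr_suml.
rewrite exchange_big; apply: eq_bigr => i _ /=; rewrite !ffunE scaler_sumr.
by apply: eq_bigr => j _; rewrite coefZ -mulrA.
Qed.

Lemma tmul_sumr N (I : Type) (r : seq I) (a : I -> R) (y : I -> tens R V N) x :
  tmul x (\sum_(i <- r) a i *: y i) = \sum_(i <- r) a i *: tmul x (y i).
Proof.
apply/ffunP => u; rewrite sum_ffunE ffunE.
under eq_bigr do rewrite coef_sum mulr_sumr.
rewrite exchange_big; apply: eq_bigr => i _ /=; rewrite !ffunE scaler_sumr.
by apply: eq_bigr => j _; rewrite coefZ mulrCA.
Qed.

Lemma tmul_tword N (v w : seq (letter V)) : (size v < N)%N -> (size w < N)%N ->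
  tmul (tword v) (tword w) = tword (v ++ w) :> tens R V N.
Proof.
move=> vN wN; apply/ffunP => u; rewrite !ffunE.
have E (i : 'I_(size (wseq u)).+1) :
    coef (tword v : tens R V N) (take i (wseq u)) *
    coef (tword w : tens R V N) (drop i (wseq u)) =
    ((i == size v :> nat) && (wseq u == v ++ w))%:R :> R.
  rewrite !coef_tword // -natrM mulnb; congr (_%:R); congr nat_of_bool.
  apply/andP/andP => [[/eqP iv /eqP iw]|[/eqP -> /eqP ->]].
    split; last by rewrite -iv -iw cat_take_drop.
    by rewrite -iv size_takel // -ltnS; exact: ltn_ord.
  by rewrite take_size_cat // drop_size_cat.
rewrite (eq_bigr _ (fun i _ => E i)); case: eqP => [uvw|_]; last first.
  by rewrite big1 // => i _; rewrite andbF.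
have sv : (size v < (size (wseq u)).+1)%N by rewrite uvw size_cat ltnS leq_addr.
rewrite (bigD1 (Ordinal sv)) //= eqxx big1 ?addr0 // => i.
by rewrite -val_eqE /= => /negbTE ->.
Qed.

Section Pairing.
Context {E : lmodType R}.
Implicit Types (Phi : seq (letter V) -> E).

Definition pairing N (x : tens R V N) Phi : E :=
  \sum_(u : word V N) (x u : R) *: Phi (wseq u).

Definition vanishing N Phi := forall w, (N <= size w)%N -> Phi w = 0.

Lemma pairing_sum N (I : Type) (r : seq I) (a : I -> R) (x : I -> tens R V N)
    Phi :
  pairing (\sum_(i <- r) a i *: x i) Phi =
  \sum_(i <- r) a i *: pairing (x i) Phi.
Proof.
rewrite /pairing; under eq_bigr do rewrite sum_ffunE scaler_suml.
rewrite exchange_big; apply: eq_bigr => i _; rewrite scaler_sumr.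
by apply: eq_bigr => u _; rewrite ffunE scalerA.
Qed.

Lemma pairing_tword N w Phi : vanishing N Phi ->
  pairing (tword w : tens R V N) Phi = Phi w.
Proof.
move=> Phi0; have [wN|Nw] := ltnP (size w) N; last first.
  rewrite Phi0 // /pairing big1 // => u _.
  by rewrite tword_long // ffunE scale0r.
have [u uw] := word_of_seq wN.
rewrite /pairing (bigD1 u) //= ffunE uw eqxx scale1r.
rewrite big1 ?addr0 // => v; rewrite ffunE -uw (inj_eq (@wseq_inj N)).
by move=> /negbTE ->; rewrite scale0r.
Qed.

Lemma vanishing_catr N Phi v :
  vanishing N Phi -> vanishing N (fun a => Phi (a ++ v)).
Proof.
by move=> P w Nw; apply: P; rewrite size_cat;
  apply: leq_trans Nw (leq_addr _ _).
Qed.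

Lemma vanishing_catl N Phi v :
  vanishing N Phi -> vanishing N (fun a => Phi (v ++ a)).
Proof.
by move=> P w Nw; apply: P; rewrite size_cat;
  apply: leq_trans Nw (leq_addl _ _).
Qed.

Lemma pairing_tmul N (x y : tens R V N) Phi : vanishing N Phi ->
  pairing (tmul x y) Phi =
  pairing x (fun a => pairing y (fun b => Phi (a ++ b))).
Proof.
move=> P; rewrite {1}[x]tens_basis {1}[y]tens_basis tmul_suml pairing_sum.
apply: eq_bigr => a _; congr (_ *: _); rewrite tmul_sumr pairing_sum.
apply: eq_bigr => b _; congr (_ *: _).
by rewrite tmul_tword ?size_wseq // pairing_tword.
Qed.

Lemma pairing_truncate N k (x : tens R V N) Phi :
  (k <= N)%N -> vanishing k Phi ->
  pairing (truncate k x) Phi = pairing x Phi.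
Proof.
move=> kN P; have -> : truncate k x = \sum_u (x u : R) *: tword (wseq u).
  apply/ffunP => v; rewrite ffunE {1}[x]tens_basis coef_sum sum_ffunE.
  apply: eq_bigr => u _; rewrite coefZ coef_tword ?size_wseq // !ffunE.
  by [].
by rewrite pairing_sum; apply: eq_bigr => u _; rewrite pairing_tword.
Qed.

Lemma tvecE N (v : V) :
  tvec v = \sum_(i : letter V) coord e i v *: tword [:: i] :> tens R V N.
Proof.
apply/ffunP => u; rewrite ffunE sum_ffunE.
rewrite (reindex (fun i : letter V => [tuple i])) /=; last first.
  exists (fun w : 1.-tuple (letter V) => thead w) => [i _|w _];
    rewrite ?theadE //.
  by apply: val_inj; case: w => -[|? []].
rewrite big_mkcond; apply: eq_bigr => i _; rewrite !ffunE eq_sym.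
case: eqP => _; last by rewrite scaler0.
by rewrite big_ord_recl big_ord0 mulr1 [_ *: _]mulr1.
Qed.

Lemma pairing_tmul_tvec N (x : tens R V N) v Phi : vanishing N Phi ->
  pairing (tmul x (tvec v)) Phi =
  \sum_(i : letter V) coord e i v *: pairing x (fun a => Phi (rcons a i)).
Proof.
move=> P; rewrite tvecE tmul_sumr pairing_sum; apply: eq_bigr => i _.
congr (_ *: _); rewrite pairing_tmul //; apply: eq_bigr => a _.
congr (_ *: _); rewrite pairing_tword ?cats1 //.
exact: (vanishing_catl _ P).
Qed.

End Pairing.
End Words.

Section WordEvaluation.
Context {R : realType} {V W : finBanachType R} {kappa lambda : nat}.
Context {F : normedModType R}.
Local Notation TT := (tens2 R V kappa W lambda).

Definition word_eval (z : {linear TT -> F}) b : F :=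
  z (box (tword b.1) (tword b.2)).

Lemma word_eval_longl z v v' : (kappa <= size v)%N -> word_eval z (v, v') = 0.
Proof.
move=> kv; rewrite /word_eval /= tword_long // (_ : box 0 _ = 0) ?linear0 //.
by apply/ffunP => u; rewrite !ffunE mul0r.
Qed.

Lemma word_eval_longr z v v' : (lambda <= size v')%N -> word_eval z (v, v') = 0.
Proof.
move=> kv; rewrite /word_eval /= [X in box _ X]tword_long //.
rewrite (_ : box _ 0 = 0) ?linear0 //.
by apply/ffunP => u; rewrite !ffunE mulr0.
Qed.

Lemma box_suml (I : Type) (r : seq I) (a : I -> R) (x : I -> tens R V kappa)
    (y : tens R W lambda) :
  box (\sum_(i <- r) a i *: x i) y = \sum_(i <- r) a i *: box (x i) y.
Proof.
apply/ffunP => u; rewrite ffunE !sum_ffunE mulr_suml.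
by apply: eq_bigr => i _; rewrite !ffunE -mulrA.
Qed.

Lemma box_sumr (I : Type) (r : seq I) (a : I -> R) (x : tens R V kappa)
    (y : I -> tens R W lambda) :
  box x (\sum_(i <- r) a i *: y i) = \sum_(i <- r) a i *: box x (y i).
Proof.
apply/ffunP => u; rewrite ffunE !sum_ffunE mulr_sumr.
by apply: eq_bigr => i _; rewrite !ffunE mulrCA.
Qed.

Lemma boxmap_tword f h v v' : (size v < kappa)%N -> (size v' < lambda)%N ->
  boxmap f h (box (tword v) (tword v')) =
  box (f (tword v)) (h (tword v')) :> TT.
Proof.
move=> vk v'l; have [u uv] := word_of_seq vk; have [u' uv'] := word_of_seq v'l.
rewrite /boxmap (bigD1 (u, u')) //= !ffunE uv uv' !eqxx mulr1 scale1r.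
rewrite big1 ?addr0 // => -[w w']; rewrite xpair_eqE !ffunE -uv -uv'.
rewrite !(inj_eq (@wseq_inj _ _ _)) -natrM mulnb => /negbTE ->.
by rewrite scale0r.
Qed.

Lemma eval_boxl (z : {linear TT -> F}) (x : tens R V kappa) v' :
  z (box x (tword v')) = pairing x (fun a => word_eval z (a, v')).
Proof.
rewrite {1}[x]tens_basis box_suml linear_sum; apply: eq_bigr => u _.
by rewrite linearZ.
Qed.

Lemma eval_boxr (z : {linear TT -> F}) v (y : tens R W lambda) :
  z (box (tword v) y) = pairing y (fun a => word_eval z (v, a)).
Proof.
rewrite {1}[y]tens_basis box_sumr linear_sum; apply: eq_bigr => u _.
by rewrite linearZ.
Qed.

Lemma eval_box (z : {linear TT -> F}) (x : tens R V kappa)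
    (y : tens R W lambda) :
  z (box x y) =
  \sum_u \sum_u' (x u * y u' : R) *: word_eval z (wseq u, wseq u').
Proof.
rewrite {1}[x]tens_basis box_suml linear_sum; apply: eq_bigr => u _.
rewrite linearZ /= eval_boxr scaler_sumr; apply: eq_bigr => u' _.
by rewrite scalerA.
Qed.

Lemma rem1_tword X (Z : R -> R -> {linear TT -> F}) s t u v v' :
  (size v < kappa)%N -> (size v' < lambda)%N ->
  rem1 X Z s t u (box (tword v) (tword v')) =
  word_eval (Z t u) (v, v') -
  pairing (X s t) (fun a => word_eval (Z s u) (a ++ v, v')).
Proof.
move=> vk v'l; have P : vanishing kappa (fun a => word_eval (Z s u) (a, v')).
  by move=> a; exact: word_eval_longl.
rewrite /rem1 boxmap_tword // [X in _ - X]eval_boxl pairing_tmul //.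
rewrite -(pairing_truncate (X s t) (leqnSn kappa) (vanishing_catr v P)).
congr (_ - _); apply: eq_bigr => a _; congr (_ *: _).
by rewrite pairing_tword //; exact: (vanishing_catl _ P).
Qed.

Lemma rem2_tword Y (Z : R -> R -> {linear TT -> F}) s t u v v' :
  (size v < kappa)%N -> (size v' < lambda)%N ->
  rem2 Y Z s t u (box (tword v) (tword v')) =
  word_eval (Z u t) (v, v') -
  pairing (Y s t) (fun a => word_eval (Z u s) (v, a ++ v')).
Proof.
move=> vk v'l; have P : vanishing lambda (fun a => word_eval (Z u s) (v, a)).
  by move=> a; exact: word_eval_longr.
rewrite /rem2 boxmap_tword // [X in _ - X]eval_boxr pairing_tmul //.
rewrite -(pairing_truncate (Y s t) (leqnSn lambda) (vanishing_catr v' P)).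
congr (_ - _); apply: eq_bigr => a _; congr (_ *: _).
by rewrite pairing_tword //; exact: (vanishing_catl _ P).
Qed.

End WordEvaluation.

(** * Horizontal curves *)

(* The coordinates of a curve are scalar; this makes the mean value inequality
   apply to them. *)
HB.instance Definition _ (R : realType) := CompleteNormedModule.on (R^o)%type.

Section Pathwise.
Context {R : realType}.

Lemma derivable_derivative_at (f : R -> R) (t : R) :
  derivable f t 1 -> derivative_at (f : R -> R^o) t (f^`() t).
Proof.
by move=> df; apply: is_derive_derivative_at; rewrite derive1E;
  exact: derivableP.
Qed.

(** The arc length is the comparison function for the mean value inequality. *)
Lemma arc_length (E : normedModType R) (u : R -> E) (L : R) :
  {within `[0, 1], continuous u} ->
  (\int[lebesgue_measure]_(t in `[0%R, 1%R]) (`|u t|%:E) <= L%:E)%E ->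
  exists phi : R -> R, [/\ {within `[0, 1], continuous phi}, phi 0 = 0,
    forall t, 0 <= t <= 1 -> phi t <= L &
    forall t, 0 < t < 1 -> derivative_at (phi : R -> R^o) t `|u t|].
Proof.
move=> uc uL; pose v t := `|u t|.
have vc : {within `[0, 1], continuous v}.
  by move=> x; apply: cvg_norm; exact: uc.
have vi : lebesgue_measure.-integrable `[0, 1] (EFin \o v).
  apply: (@continuous_compact_integrable _ v) => //; exact: segment_compact.
pose phi t := parameterized_integral lebesgue_measure 0 t v.
have phic : {within `[0, 1], continuous phi}.
  exact: parameterized_integral_continuous.
have phid t : 0 < t < 1 -> derivable phi t 1 /\ phi^`() t = v t.
  move=> /andP[t0 t1]; apply: (continuous_FTC1_closed t1 vi t0).
  by apply: (within_continuous_continuous ltr01 vc); rewrite in_itv /= t0.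
exists phi; split=> //.
- by rewrite /phi /parameterized_integral set_itv1 Rintegral_set1.
- move=> t t01; have phi1 : phi 1 <= L.
    rewrite -lee_fin; apply: le_trans uL.
    rewrite /phi /parameterized_integral /Rintegral fineK //.
    exact: integrable_fin_num.
  apply: le_trans phi1.
  case/andP: (t01) => _ t1; apply: (@ger0_derive1_le_cc _ phi 0 1) => //.
  + by move=> x; rewrite in_itv /= => /phid[].
  + by move=> x; rewrite in_itv /= => /phid[_ ->]; exact: normr_ge0.
  + by rewrite in_itv /= ler01 lexx.
- by move=> t /phid[dphi dv]; have := derivable_derivative_at dphi; rewrite dv.
Qed.

End Pathwise.

Section Horizontal.
Context {R : realType} {V : finBanachType R}.
Local Notation e := (vbasis (@fullv _ V)).

(** The coordinates of [u] are bounded by its norm, whose integral is at most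
    [L]. All the estimates along horizontal curves iterate this one. *)
Lemma driven_increment (E : finBanachType R) : exists2 c : R, 0 <= c &
  forall (u : R -> V) (L : R) (f : R -> E) (G : letter V -> R -> E)
      (B : letter V -> R),
    {within `[0, 1], continuous u} ->
    (\int[lebesgue_measure]_(t in `[0%R, 1%R]) (`|u t|%:E) <= L%:E)%E ->
    {within `[0, 1], continuous f} ->
    (forall t, 0 < t < 1 ->
       derivative_at f t (\sum_i coord e i (u t) *: G i t)) ->
    (forall i t, 0 <= t <= 1 -> `|G i t| <= B i) ->
    forall t, 0 <= t <= 1 -> `|f t - f 0| <= c * L * \sum_i B i.
Proof.
have [c c0 mvi] := @mean_value_inequality R E.
have [k k0 kP] := @coord_bounded R V.
exists (c * k); first by rewrite mulr_ge0 // ltW.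
move=> u L f G B uc uL fc fd GB t /andP[t0 t1].
have [phi [phic phi0 phiL phid]] := arc_length uc uL.
have sub : `[0, t] `<=` `[0, 1 : R] by apply: subset_itvl; rewrite bnd_simp.
have B0 i : 0 <= B i by apply: le_trans (GB i 0 _) => //; rewrite lexx ler01.
pose b := \sum_i B i; have b0 : 0 <= b by rewrite sumr_ge0.
have tlt x : 0 < x < t -> 0 < x < 1.
  by move=> /andP[-> xt] /=; apply: lt_le_trans t1.
have := mvi f (fun t => \sum_i coord e i (u t) *: G i t)
  (fun x => (k * b) * phi x) (fun x => (k * b) * `|u x|) 0 t t0.
rewrite phi0 mulr0 subr0 => H; apply: le_trans (H _ _ _ _ _) _.
- exact: continuous_subspaceW sub fc.
- move=> x; apply: cvgMr; exact: (continuous_subspaceW sub phic).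
- by move=> x /tlt; exact: fd.
- by move=> x /tlt xt; apply: (@derivative_atZ R R^o); exact: phid.
- move=> x /tlt /andP[x0 x1]; apply: le_trans (ler_norm_sum _ _ _) _.
  rewrite mulrAC mulr_sumr; apply: ler_sum => i _; rewrite normrZ.
  by apply: ler_pM => //; rewrite ?kP ?GB ?ltW.
- have -> : c * k * L * b = c * (k * b * L) by ring.
  apply: ler_wpM2l => //; apply: ler_wpM2l; first by rewrite mulr_ge0 // ltW.
  by apply: phiL; rewrite t0.
Qed.

Context {N : nat}.

Lemma pairing_derivative (E : normedModType R) (gamma : R -> tens R V N)
    (gamma' : tens R V N) Phi t :
  (forall w, derivative_at (fun s => gamma s w : R^o) t (gamma' w)) ->
  derivative_at (fun s => pairing (gamma s) Phi : E) t (pairing gamma' Phi).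
Proof.
by move=> gd; apply: derivative_at_sum => w; apply: derivative_atZl; exact: gd.
Qed.

Lemma pairing_continuous (E : normedModType R) (gamma : R -> tens R V N) Phi A :
  (forall w, {within A, continuous (fun s => gamma s w)}) ->
  {within A, continuous (fun s => pairing (gamma s) Phi : E)}.
Proof.
move=> gc x; apply: (@cvg_big _ _ _ _ _ add_continuous _ (nbhs x)) => w _.
by apply: (@cvgZr_tmp _ _ _ (nbhs x)); exact: gc.
Qed.

Lemma pairing_bound (E : normedModType R) (x : tens R V N)
    (Phi : seq (letter V) -> E)
    (a b : R) : 0 <= b ->
  (forall u, `|x u| <= a) -> (forall w, (size w < N)%N -> `|Phi w| <= b) ->
  `|pairing x Phi| <= #|{: word V N}|%:R * (a * b).
Proof.
move=> b0 xa Phib; apply: le_trans (ler_norm_sum _ _ _) _.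
rewrite mulr_natl -sumr_const; apply: ler_sum => u _; rewrite normrZ.
by apply: ler_pM => //; apply: Phib; exact: size_wseq.
Qed.

End Horizontal.

Section HorizontalBounds.
Context {R : realType} {V : finBanachType R} {N : nat}.
Local Notation e := (vbasis (@fullv _ V)).
Implicit Types (u : R -> V) (gamma : R -> tens R V N.+1).

Definition horizontal_from1 L u gamma :=
  [/\ horizontal u gamma, gamma 0 = tone &
    (\int[lebesgue_measure]_(t in `[0%R, 1%R]) (`|u t|%:E) <= L%:E)%E].

(** A horizontal curve is extended by letters on the right of its words. *)
Lemma horizontal_pairing_derivative (E : normedModType R) L u gamma
    (Phi : seq (letter V) -> E) t :
  horizontal_from1 L u gamma -> vanishing N.+1 Phi -> 0 < t < 1 ->
  derivative_at (fun s => pairing (gamma s) Phi) t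
    (\sum_i coord e i (u t) *: pairing (gamma t) (fun a => Phi (rcons a i))).
Proof.
move=> [[_ _ _ gd] _ _] P t01; rewrite -pairing_tmul_tvec //.
by apply: pairing_derivative => w; apply: is_derive_derivative_at; exact: gd.
Qed.

Lemma horizontal_pairing_continuous (E : normedModType R) L u gamma
    (Phi : seq (letter V) -> E) :
  horizontal_from1 L u gamma ->
  {within `[0, 1], continuous (fun s => pairing (gamma s) Phi)}.
Proof. by move=> [[_ _ gc _] _ _]; exact: pairing_continuous. Qed.

Lemma pairing_coef (x : tens R V N.+1) w : (size w < N.+1)%N ->
  pairing x (fun a => (a == w)%:R : R^o) = coef x w.
Proof.
move=> wN; rewrite /pairing /coef [RHS]big_mkcond; apply: eq_bigr => u _.
by case: eqP => _; rewrite ?scaler0 // [LHS]mulr1.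
Qed.

Lemma horizontal_coef_nil L u gamma t : horizontal_from1 L u gamma ->
  0 <= t <= 1 -> coef (gamma t) [::] = 1.
Proof.
move=> hor t01; have [c c0 cP] := @driven_increment R V R^o.
have [uc _ _ _] := (let: And3 h _ _ := hor in h).
have uL : (\int[lebesgue_measure]_(t in `[0%R, 1%R]) (`|u t|%:E) <= L%:E)%E.
  by case: hor.
pose d a : R^o := (a == [::] :> seq (letter V))%:R.
have := cP u L (fun s => pairing (gamma s) d) (fun _ _ => 0) (fun=> 0) uc uL.
rewrite pairing_coef //= big1 // mulr0.
have -> : gamma 0 = tone by case: hor.
rewrite coef_tword // eqxx => H.
have {H} : `|coef (gamma t) [::] - 1 : R^o| <= 0.
  rewrite -pairing_coef //; apply: H => //.
  - exact: horizontal_pairing_continuous hor.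
  - move=> s s01; have := horizontal_pairing_derivative (Phi := d) hor _ s01.
    have -> : \sum_i coord e i (u s) *:
          pairing (gamma s) (fun a => d (rcons a i)) =
        \sum_i coord e i (u s) *: (0 : R^o).
      apply: eq_bigr => i _; congr (_ *: _); rewrite /pairing big1 // => a _.
      by rewrite /d; case: (wseq a) => [|? ?]; rewrite scaler0.
    by apply => -[].
  - by move=> i s _; rewrite normr0.
by rewrite normr_le0 subr_eq0 => /eqP.
Qed.

(** The coordinate at [w] of a horizontal curve is an iterated integral of order
    [size w] of its speed. *)
Lemma horizontal_coef_bound : exists2 c : R, 0 <= c &
  forall L u gamma, horizontal_from1 L u gamma ->
  forall t, 0 <= t <= 1 -> forall w, `|coef (gamma t) w| <= (c * L) ^+ size w.
Proof.
have [c c0 cP] := @driven_increment R V R^o.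
exists c => // L u gamma hor t t01 w.
have [uc _ _ _] := (let: And3 h _ _ := hor in h).
have uL : (\int[lebesgue_measure]_(t in `[0%R, 1%R]) (`|u t|%:E) <= L%:E)%E.
  by case: hor.
have L0 : 0 <= L.
  by rewrite -lee_fin; apply: le_trans uL; exact: integral_ge0.
have cL : 0 <= c * L by exact: mulr_ge0.
have [wN|Nw] := ltnP (size w) N.+1; last first.
  by rewrite coef_long // normr0 exprn_ge0.
elim/last_ind: w wN t t01 => [|w j IH] wN t t01.
  by rewrite (horizontal_coef_nil hor t01) normr1 expr0.
have wN' : (size w < N.+1)%N by move: wN; rewrite size_rcons => /ltnW.
pose d a : R^o := (a == rcons w j)%:R.
have := cP u L (fun s => pairing (gamma s) d)
  (fun i s => pairing (gamma s) (fun a => d (rcons a i)))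
  (fun i => (i == j)%:R * (c * L) ^+ size w) uc uL.
rewrite -mulr_suml (bigD1 j) //= eqxx big1 ?addr0 ?mul1r; last first.
  by move=> i /negbTE ->.
have -> : gamma 0 = tone by case: hor.
rewrite !pairing_coef // coef_tword //.
have -> : (rcons w j == [::]) = false by case: (w).
move=> H; have : `|coef (gamma t) (rcons w j) - 0| <= c * L * (c * L) ^+ size w.
  rewrite -(pairing_coef (gamma t)) //; apply: H => //.
  - exact: horizontal_pairing_continuous hor.
  - move=> s s01; apply: (horizontal_pairing_derivative hor) => // a Na.
    rewrite /d; case: eqP => // aw.
    by move: wN; rewrite -aw ltnNge Na.
  - move=> i s s01.
    have -> : (fun a => d (rcons a i)) =
        (fun a => (i == j)%:R *: ((a == w)%:R : R^o)).
      apply/funext => a; rewrite /d eqseq_rcons; case: eqP => _;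
        case: eqP => _ //=;
      by rewrite ?scale1r ?scale0r ?scaler0.
    have -> : pairing (gamma s) (fun a => (i == j)%:R *: ((a == w)%:R : R^o)) =
        (i == j)%:R *: pairing (gamma s) (fun a => (a == w)%:R : R^o).
      rewrite /pairing scaler_sumr; apply: eq_bigr => a _.
      by rewrite !scalerA mulrC.
    rewrite pairing_coef // normrZ ger0_norm ?ler0n //.
    by apply: ler_wpM2l => //; exact: IH.
by rewrite subr0 size_rcons exprS.
Qed.

End HorizontalBounds.

(** * The Faa di Bruno sum over set partitions *)

Section FaaDiBruno.
Context {R : realType} {F : normedModType R} {S : finBanachType R}.
Variable g : F -> S.
Hypothesis g_smooth : frechet_smooth g.
Context {A B : eqType}.
Local Notation block := (seq A * seq B)%type.

Definition faa_di_bruno (zeta : block -> F) w w' : S :=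
  \sum_(pi <- partitions w w')
    frechet g [seq zeta b | b <- pi] (zeta empty_block).

Lemma sum_replace_one (I : Type) (r : seq I) (a : I -> R)
    (op : I -> block -> block)
    (f : block -> F) (M : seq F -> S) pi : multilinear M ->
  \sum_(s <- replace_one f (fun b => \sum_(i <- r) a i *: f (op i b)) pi) M s =
  \sum_(i <- r) a i *: \sum_(t <- alter_one (op i) pi) M [seq f b | b <- t].
Proof.
elim: pi M => [|b pi IH] M ML /=.
  by rewrite big_nil big1 // => i _; rewrite big_nil scaler0.
rewrite big_cons big_map (IH (fun s => M (f b :: s)));
  last exact: multilinear_cons.
rewrite (multilinear_sum ML _ [::]) -big_split; apply: eq_bigr => i _ /=.
by rewrite big_cons big_map scalerDr (multilinearZ ML [::]).
Qed.

Lemma faa_di_bruno_cons (zeta : block -> F) i w w' :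
  faa_di_bruno zeta (i :: w) w' =
  \sum_(pi <- partitions w w')
    (frechet g (zeta ([:: i], [::]) :: [seq zeta b | b <- pi])
       (zeta empty_block) +
     \sum_(t <- alter_one (consl i) pi)
        frechet g [seq zeta b | b <- t] (zeta empty_block)).
Proof.
rewrite /faa_di_bruno [partitions _ _]/= big_flatten big_map.
by apply: eq_bigr => pi _; rewrite big_cons.
Qed.

(** Differentiating the base point creates a block with one letter, and
    differentiating an entry makes an old block longer; so the derivative runs
    over the partitions of the word with one more letter. *)
Lemma faa_di_bruno_derivative (I : finType) (letter_of : I -> A)
    (zeta : R -> block -> F) t (a : I -> R) w w' :
  (forall b, derivative_at (zeta^~ b) t
     (\sum_i a i *: zeta t (consl (letter_of i) b))) ->
  derivative_at (fun s => faa_di_bruno (zeta s) w w') t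
    (\sum_i a i *: faa_di_bruno (zeta t) (letter_of i :: w) w').
Proof.
move=> zd.
have -> : \sum_i a i *: faa_di_bruno (zeta t) (letter_of i :: w) w' =
  \sum_(pi <- partitions w w')
   (frechet g ((\sum_i a i *: zeta t (consl (letter_of i) empty_block)) ::
       [seq zeta t b | b <- pi]) (zeta t empty_block) +
    \sum_(s <- replace_one (zeta t)
        (fun b => \sum_i a i *: zeta t (consl (letter_of i) b)) pi)
      frechet g s (zeta t empty_block)).
  under eq_bigr do rewrite faa_di_bruno_cons scaler_sumr.
  rewrite exchange_big; apply: eq_bigr => pi _.
  have ML := frechet_multilinear g_smooth (zeta t empty_block).
  rewrite (sum_replace_one _ _ _ _ _ ML) frechet_head_sum -big_split.
  by apply: eq_bigr => i _; rewrite scalerDr.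
apply: derivative_at_sum => pi.
by apply: frechet_derivative.
Qed.

Lemma faa_di_bruno_continuous (T : topologicalType) (D : set T)
    (zeta : T -> block -> F) w w' :
  (forall b, {within D, continuous (zeta^~ b)}) ->
  {within D, continuous (fun s => faa_di_bruno (zeta s) w w')}.
Proof.
move=> zc x; apply: (@cvg_big _ _ _ _ _ add_continuous _ (nbhs x)) => pi _.
by apply: frechet_cvg => [//|b|]; exact: zc.
Qed.

Section Bounds.
Variables (K : set F) (B1 : R).
Hypotheses (Kc : compact K) (B1_ge1 : 1 <= B1).

Lemma prod_norm_le (f : block -> F) pi : (forall b, `|f b| <= B1) ->
  \prod_(b <- pi) `|f b| <= B1 ^+ size pi.
Proof.
move=> fB; elim: pi => [|b pi IH]; first by rewrite big_nil.
by rewrite big_cons exprS; apply: ler_pM => //; exact: prodr_ge0.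
Qed.

Lemma replace_one_le (f f' : block -> F) (P : pred block) eps pi :
  0 <= eps -> (forall b, `|f b| <= B1) -> (forall b, P b -> `|f' b| <= eps) ->
  all P pi ->
  all (fun s => (size s == size pi) &&
      (\prod_(v <- s) `|v| <= eps * B1 ^+ size pi))
    (replace_one f f' pi).
Proof.
move=> eps0 fB f'e; have B10 : 0 <= B1 by exact: le_trans B1_ge1.
elim: pi => //= b pi IH /andP[Pb Ppi].
rewrite size_map eqxx /=; apply/andP; split.
  rewrite big_cons big_map exprS; apply: ler_pM => //; first exact: prodr_ge0.
    exact: f'e.
  apply: le_trans (prod_norm_le pi fB) _; apply: ler_peMl => //.
  exact: exprn_ge0.
rewrite all_map; apply: sub_all (IH Ppi) => s /= /andP[/eqP -> sP].
rewrite eqxx big_cons exprS mulrCA /=; apply: ler_pM => //.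
exact: prodr_ge0.
Qed.

Lemma sum_norm_le (T : Type) (E : normedModType R) (P : pred T) (s : seq T)
    (f : T -> E) (C : R) : all P s -> (forall x, P x -> `|f x| <= C) ->
  `|\sum_(x <- s) f x| <= C *+ size s.
Proof.
move=> + fC; elim: s => [|x s IH] /=; first by rewrite big_nil normr0.
move=> /andP[Px Ps]; rewrite big_cons mulrS; apply: le_trans (ler_normD _ _) _.
by apply: lerD; [exact: fC|exact: IH].
Qed.

Lemma faa_di_bruno_bounded w w' : exists2 C : R, 0 <= C &
  forall zeta : block -> F, (forall b, `|zeta b| <= B1) ->
    K (zeta empty_block) ->
  `|faa_di_bruno zeta w w'| <= C.
Proof.
have B10 : 0 <= B1 by exact: le_trans B1_ge1.
rewrite /faa_di_bruno; elim: (partitions w w') => [|pi P [C C0 CP]].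
  by exists 0 => // zeta _ _; rewrite big_nil normr0.
have [D D0 DP] := frechet_bounded_compact g_smooth (size pi) Kc.
exists (D * B1 ^+ size pi + C).
  by rewrite addr_ge0 // mulr_ge0 // exprn_ge0.
move=> zeta zB zK; rewrite big_cons; apply: le_trans (ler_normD _ _) _.
apply: lerD; last exact: CP.
apply: le_trans (DP _ _ zK _) _; first by rewrite size_map.
by rewrite big_map; apply: ler_wpM2l => //; exact: prod_norm_le.
Qed.

(** Along the segment from [zeta0] to [zeta1] every term of the derivative has
    exactly one factor [zeta1 b - zeta0 b]. *)
Lemma faa_di_bruno_lipschitz w w' : exists2 C : R, 0 <= C &
  forall (zeta0 zeta1 : block -> F) eps, 0 <= eps ->
  (forall b, (size b.1 <= size w)%N -> `|zeta1 b - zeta0 b| <= eps) ->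
  (forall (t : R) b, 0 <= t <= 1 ->
     `|zeta0 b + t *: (zeta1 b - zeta0 b)| <= B1) ->
  (forall t : R, 0 <= t <= 1 ->
     K (zeta0 empty_block + t *: (zeta1 empty_block - zeta0 empty_block))) ->
  `|faa_di_bruno zeta1 w w' - faa_di_bruno zeta0 w w'| <= C * eps.
Proof.
have B10 : 0 <= B1 by exact: le_trans B1_ge1.
have [c c0 mvi] := @mean_value_inequality R S.
have := size_blocks_partitions w w'.
rewrite /faa_di_bruno; elim: (partitions w w') => [_|pi P IH].
  by exists 0 => // *; rewrite !big_nil subrr normr0 mul0r.
rewrite /= => /andP[pi_w /IH[C C0 CP]].
have [D D0 DP] := frechet_bounded_compact g_smooth (size pi) Kc.
have [D' D'0 D'P] := frechet_bounded_compact g_smooth (size pi).+1 Kc.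
pose M := D' * B1 ^+ size pi + (D * B1 ^+ size pi) *+ size pi.
have M0 : 0 <= M.
  by rewrite addr_ge0 ?mulrn_wge0 // mulr_ge0 // exprn_ge0.
exists (c * M + C); first by rewrite addr_ge0 // mulr_ge0.
move=> zeta0 zeta1 eps eps0 ze zB zK.
rewrite !big_cons opprD addrACA mulrDl.
apply: le_trans (ler_normD _ _) _; apply: lerD; last exact: CP.
pose zeta (t : R) b := zeta0 b + t *: (zeta1 b - zeta0 b).
pose dz b := zeta1 b - zeta0 b.
have zd t b : derivative_at (zeta^~ b) t (dz b).
  rewrite /zeta -[dz b]subr0 -[_ - 0]opprK.
  have -> : (fun t => zeta0 b + t *: (zeta1 b - zeta0 b)) =
     (fun t : R => t *: dz b - (fun=> - zeta0 b) t).
    by apply/funext => s; rewrite opprK addrC.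
  rewrite opprK; apply: derivative_atB; last exact: derivative_at_cst.
  rewrite -[X in derivative_at _ _ X]scale1r.
  by apply: derivative_atZl; exact: derivative_at_id.
pose f t := frechet g [seq zeta t b | b <- pi] (zeta t empty_block).
pose f' t :=
   frechet g (dz empty_block :: [seq zeta t b | b <- pi]) (zeta t empty_block) +
   \sum_(s <- replace_one (zeta t) dz pi) frechet g s (zeta t empty_block).
have fd t : derivative_at f t (f' t) by apply: frechet_derivative.
have := mvi f f' (fun t => (M * eps) * t) (fun=> M * eps) 0 1 ler01.
have -> : f 1 = frechet g [seq zeta1 b | b <- pi] (zeta1 empty_block).
  have z1 b : zeta 1 b = zeta1 b by rewrite /zeta scale1r addrC subrK.
  by rewrite /f z1 (eq_map z1).
have -> : f 0 = frechet g [seq zeta0 b | b <- pi] (zeta0 empty_block).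
  have z0 b : zeta 0 b = zeta0 b by rewrite /zeta scale0r addr0.
  by rewrite /f z0 (eq_map z0).
rewrite mulr0 subr0 mulr1 mulrA; apply.
- by apply: continuous_subspaceT => t; exact: derivative_at_continuous (fd t).
- by apply: continuous_subspaceT => t; apply: cvgMr; exact: cvg_id.
- by move=> t _; exact: fd.
- move=> t _; rewrite -[X in derivative_at _ _ X]mulr1.
  by apply: (@derivative_atZ R R^o); exact: derivative_at_id.
move=> t /andP[/ltW t0 /ltW t1]; have t01 : 0 <= t <= 1 by rewrite t0.
apply: le_trans (ler_normD _ _) _; rewrite mulrDl; apply: lerD.
  apply: le_trans (D'P _ _ (zK t t01) _) _; first by rewrite /= size_map.
  rewrite -mulrA; apply: ler_wpM2l => //; rewrite big_cons big_map mulrC.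
  apply: ler_pM => //; first exact: prodr_ge0.
    by apply: prod_norm_le => b; exact: zB.
  exact: ze.
have tz b : `|zeta t b| <= B1 by exact: zB.
have := @replace_one_le (zeta t) dz _ eps pi eps0 tz ze pi_w.
have sz : size (replace_one (zeta t) dz pi) = size pi.
  elim: (pi) => //= b s IHs; rewrite size_map; congr _.+1; move: IHs.
  by elim: (s).
move=> /sum_norm_le H; apply: le_trans (H _ _ (D * B1 ^+ size pi * eps) _) _.
  move=> s /andP[/eqP ss sP]; apply: le_trans (DP _ _ (zK t t01) ss) _.
  by rewrite -mulrA; apply: ler_wpM2l => //; rewrite mulrC.
by rewrite sz mulrnAl.
Qed.

End Bounds.
End FaaDiBruno.

Section CurveError.
Context {R : realType} {V : finBanachType R} {F : normedModType R}.
Context {S : finBanachType R} {kappa : nat} {B : eqType}.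
Local Notation A := (letter V).
Local Notation block := (seq A * seq B)%type.
Local Notation e := (vbasis (@fullv _ V)).
Variable g : F -> S.
Hypothesis g_smooth : frechet_smooth g.

(** The composition of [zeta] with the left multiplication by [x]. *)
Definition left_shift (x : tens R V kappa.+1) (zeta : block -> F)
    (b : block) : F :=
  pairing x (fun a => zeta (a ++ b.1, b.2)).

Definition cut_faa_di_bruno (zeta : block -> F) (w' : seq B) (w : seq A) : S :=
  if (size w < kappa)%N then faa_di_bruno g zeta w w' else 0.

(** For a group-like [x] and in the absence of truncation this would be zero,
    the left multiplication by [x] being compatible with the coproduct. *)
Definition shift_error (x : tens R V kappa.+1) zeta w w' : S :=
  faa_di_bruno g (left_shift x zeta) w w' -
  pairing x (fun a => cut_faa_di_bruno zeta w' (a ++ w)).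

Definition level_vanishing (zeta : block -> F) :=
  forall v v', (kappa <= size v)%N -> zeta (v, v') = 0.

Lemma left_shift_vanishing zeta b : level_vanishing zeta ->
  vanishing kappa.+1 (fun a => zeta (a ++ b.1, b.2)).
Proof.
move=> z0 a ka; apply: z0; rewrite size_cat.
by apply: leq_trans (leq_trans (leqnSn _) ka) (leq_addr _ _).
Qed.

Lemma cut_vanishing zeta w w' :
  vanishing kappa.+1 (fun a => cut_faa_di_bruno zeta w' (a ++ w)).
Proof.
move=> a ka; rewrite /cut_faa_di_bruno ltnNge size_cat.
by rewrite (leq_trans (leq_trans (leqnSn _) ka) (leq_addr _ _)).
Qed.

(** The error satisfies a triangular linear system: its derivative at [w] is
    driven by the errors at the words [i :: w]. At words of length [kappa] it is
    merely bounded, so it is an iterated integral of order [kappa - size w] at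
    [w]. *)
Lemma shift_error_bound (K : set F) (rho Bd : R) :
  compact K -> 0 <= rho -> 0 <= Bd ->
  forall n w w', (size w + n = kappa)%N -> exists2 C : R, 0 <= C &
  forall L u gamma zeta, horizontal_from1 L u gamma ->
    (forall t, 0 <= t <= 1 -> forall v, `|gamma t v| <= rho) ->
    level_vanishing zeta -> (forall b, `|zeta b| <= Bd) ->
    (forall t, 0 <= t <= 1 -> K (left_shift (gamma t) zeta empty_block)) ->
  forall t, 0 <= t <= 1 -> `|shift_error (gamma t) zeta w w'| <= C * L ^+ n.
Proof.
move=> Kc rho0 Bd0; have [c c0 cP] := @driven_increment R V S.
(* The left shifts of [zeta] along the curve are bounded by [B1]. *)
pose B1 := 1 + #|{: word V kappa.+1}|%:R * (rho * Bd).
have B11 : 1 <= B1 by rewrite lerDl !mulr_ge0.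
elim=> [|n IH] w w' wn.
  have [C C0 CP] := faa_di_bruno_bounded g_smooth Kc B11 w w'.
  exists C => // L u gamma zeta hor gr z0 zB zK t t01.
  rewrite expr0 mulr1 /shift_error.
  have -> : pairing (gamma t) (fun a => cut_faa_di_bruno zeta w' (a ++ w)) = 0.
    rewrite /pairing big1 // => a _; rewrite /cut_faa_di_bruno ltnNge size_cat.
    have -> : (kappa <= size (wseq a) + size w)%N.
      by apply: leq_trans (leq_addl _ _); rewrite -[leqRHS]addn0 wn.
    by rewrite scaler0.
  rewrite subr0; apply: CP; last exact: zK.
  move=> b; apply: (@le_trans _ _ (B1 - 1)); last by rewrite lerBlDr lerDl.
  rewrite /B1 addrAC subrr add0r; apply: pairing_bound => //.
  exact: gr.
have /choice[C CP] : forall i : A, exists C : R, 0 <= C /\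
  forall L u gamma zeta, horizontal_from1 L u gamma ->
    (forall t, 0 <= t <= 1 -> forall v, `|gamma t v| <= rho) ->
    level_vanishing zeta -> (forall b, `|zeta b| <= Bd) ->
    (forall t, 0 <= t <= 1 -> K (left_shift (gamma t) zeta empty_block)) ->
  forall t, 0 <= t <= 1 ->
    `|shift_error (gamma t) zeta (i :: w) w'| <= C * L ^+ n.
  move=> i; have [|C C0 CP] := IH (i :: w) w'; first by rewrite /= addSnnS.
  by exists C.
exists (c * \sum_i C i).
  by rewrite mulr_ge0 // sumr_ge0 // => i _; have [] := CP i.
move=> L u gamma zeta hor gr z0 zB zK t t01.
have [uc _ _ _] := (let: And3 h _ _ := hor in h).
have g0 : gamma 0 = tone by case: hor.
have uL : (\int[lebesgue_measure]_(t in `[0%R, 1%R]) (`|u t|%:E) <= L%:E)%E.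
  by case: hor.
have E0 : shift_error (gamma 0) zeta w w' = 0.
  rewrite /shift_error g0 pairing_tword; last exact: cut_vanishing.
  have wk : (size w < kappa)%N.
    by move: wn; rewrite addnS => wn; rewrite -[leqRHS]wn ltnS leq_addr.
  rewrite /cut_faa_di_bruno /= wk.
  have -> : left_shift tone zeta = zeta.
    apply/funext => -[v v']; rewrite /left_shift pairing_tword //.
    exact: left_shift_vanishing.
  by rewrite subrr.
rewrite -[shift_error _ _ _ _]subr0 -E0.
have -> : c * (\sum_i C i) * L ^+ n.+1 = c * L * \sum_i (C i * L ^+ n).
  by rewrite -mulr_suml exprS; ring.
apply: (cP u L (fun t => shift_error (gamma t) zeta w w')
  (fun i t => shift_error (gamma t) zeta (i :: w) w')) => //.
- move=> x; apply: cvgB.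
    apply: faa_di_bruno_continuous => // b.
    exact: horizontal_pairing_continuous hor.
  exact: (horizontal_pairing_continuous
    (Phi := fun a => cut_faa_di_bruno zeta w' (a ++ w)) hor).
- move=> s s01.
  have -> : \sum_i coord e i (u s) *: shift_error (gamma s) zeta (i :: w) w' =
    \sum_i coord e i (u s) *:
      faa_di_bruno g (left_shift (gamma s) zeta) (i :: w) w' -
    \sum_i coord e i (u s) *:
      pairing (gamma s) (fun a => cut_faa_di_bruno zeta w' (rcons a i ++ w)).
    rewrite -sumrB; apply: eq_bigr => i _; rewrite -scalerBr;
      congr (_ *: (_ - _)).
    by apply: eq_bigr => a _; rewrite cat_rcons.
  apply: derivative_atB.
    apply: (faa_di_bruno_derivative g_smooth (letter_of := id)) => b.
    have -> : \sum_i coord e i (u s) *: left_shift (gamma s) zeta (consl i b) =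
      \sum_i coord e i (u s) *:
        pairing (gamma s) (fun a => zeta (rcons a i ++ b.1, b.2)).
      apply: eq_bigr => i _; congr (_ *: _); apply: eq_bigr => a _.
      by rewrite cat_rcons.
    apply: (horizontal_pairing_derivative
      (Phi := fun a => zeta (a ++ b.1, b.2)) hor) => //.
    exact: left_shift_vanishing.
  apply: (horizontal_pairing_derivative
    (Phi := fun a => cut_faa_di_bruno zeta w' (a ++ w)) hor) => //.
  exact: cut_vanishing.
- by move=> i s s01; have [_ /(_ _ _ _ _ hor gr z0 zB zK)] := CP i; apply.
Qed.

End CurveError.

(** * The estimate in one parameter *)

Section CompactSets.
Context {R : realType} {F : normedModType R}.

Definition add_set (A B : set F) : set F := [set x.1 + x.2 | x in A `*` B].

Definition dilate_set (r : R) (A : set F) : set F :=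
  [set x.1 *: x.2 | x in `[- r, r] `*` A].

Lemma compact_add_set A B : compact A -> compact B -> compact (add_set A B).
Proof.
move=> Ac Bc; apply: (continuous_compact (f := fun x : F * F => x.1 + x.2)).
  by apply: continuous_subspaceT; exact: add_continuous.
exact: compact_setX.
Qed.

Lemma compact_dilate_set r A : compact A -> compact (dilate_set r A).
Proof.
move=> Ac; apply: (continuous_compact (f := fun x : R * F => x.1 *: x.2)).
  by apply: continuous_subspaceT; exact: scale_continuous.
by apply: compact_setX => //; exact: segment_compact.
Qed.

Lemma add_setP (A B : set F) x y : A x -> B y -> add_set A B (x + y).
Proof. by move=> Ax By; exists (x, y). Qed.

Lemma dilate_setP r (A : set F) c x :
  `|c| <= r -> A x -> dilate_set r A (c *: x).
Proof.
move=> cr Ax; exists (c, x) => //; split=> //=.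
by rewrite in_itv /= -ler_norml.
Qed.

Fixpoint sum_set (I : Type) (A : I -> set F) (r : seq I) : set F :=
  if r is i :: r' then add_set (A i) (sum_set A r') else [set 0].

Lemma compact_sum_set (I : Type) (A : I -> set F) r :
  (forall i, compact (A i)) -> compact (sum_set A r).
Proof.
move=> Ac; elim: r => [|i r IH] /=; first exact: compact_set1.
exact: compact_add_set.
Qed.

Lemma sum_setP (I : Type) (A : I -> set F) r (x : I -> F) :
  (forall i, A i (x i)) -> sum_set A r (\sum_(i <- r) x i).
Proof.
move=> Ax; elim: r => [|i r IH] /=; first by rewrite big_nil.
by rewrite big_cons; exact: add_setP.
Qed.

End CompactSets.

Section OneSided.
Context {R : realType} {V : finBanachType R} {F : normedModType R}.
Context {S : finBanachType R} {kappa : nat} {B : eqType}.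
Local Notation A := (letter V).
Local Notation block := (seq A * seq B)%type.

Lemma control_le (a b : R) omega s t : control a b omega ->
  a <= s -> s <= t -> t <= b -> omega s t <= omega a b.
Proof.
move=> [_ om0 omadd _] as_ st tb; have ab := le_trans as_ (le_trans st tb).
have H1 : omega a t <= omega a b.
  apply: le_trans (omadd a t b _ _ _ _) => //; last exact: le_trans st.
  by rewrite lerDl om0 // (le_trans as_).
apply: le_trans H1; apply: le_trans (omadd a s t _ _ _ _) => //.
by rewrite lerDr om0 // (le_trans st).
Qed.

Lemma control_pow_le (a b p : R) omega s t : 0 < p -> control a b omega ->
  a <= s -> s <= t -> t <= b ->
  0 <= omega s t `^ p^-1 <= omega a b `^ p^-1.
Proof.
move=> p0 om as_ st tb; rewrite powR_ge0 /=; case: (om) => _ om0 _ _.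
have ab := le_trans as_ (le_trans st tb).
apply: ge0_ler_powR; rewrite ?nnegrE ?invr_ge0 ?(ltW p0) ?om0 //.
exact: (control_le om).
Qed.

(** The distance is an infimum of lengths, hence the strict inequality. *)
Lemma Cpow_horizontal (p : R) omega a b (X : R -> R -> tens R V kappa.+1) :
  Cpow p omega a b X -> exists2 C : R, 0 <= C &
  forall s t L, a <= s -> s <= t -> t <= b -> C * omega s t `^ p^-1 < L ->
  exists u gamma, horizontal_from1 L u gamma /\ gamma 1 = X s t.
Proof.
move=> [_ [C CP]]; exists `|C| => // s t L as_ st tb CL.
have : (cc_dist tone (X s t) < L%:E)%E.
  apply: le_lt_trans (CP _ _ as_ st tb) _; rewrite lte_fin.
  apply: le_lt_trans CL; apply: ler_wpM2r; [exact: powR_ge0|exact: ler_norm].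
move=> /ereal_inf_lt[_ [u [gamma [hor g0 g1 ->]]] uL].
by exists u, gamma; split=> //; split=> //; exact: ltW.
Qed.

(** Lengths of curves exceed the distance by an arbitrarily small amount. If [W]
    is positive they are absorbed in the constant; otherwise they tend to 0. *)
Lemma power_bound_limit (x C c W M : R) n : 0 <= C -> 0 <= c -> 0 <= W <= M ->
  (forall L, c * W < L -> L <= (c + 1) * M + 1 -> x <= C * L ^+ n.+1) ->
  x <= C * (c + 1) ^+ n.+1 * W ^+ n.+1.
Proof.
move=> C0 c0 /andP[W0 WM] xL.
have cM0 : 0 <= (c + 1) * M by rewrite mulr_ge0 ?addr_ge0 // (le_trans W0).
move: W0; rewrite le_eqVlt => /predU1P[W0|W0]; last first.
  rewrite -mulrA -exprMn; apply: xL.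
    by rewrite ltr_pM2r // ltrDl.
  by apply: ler_wpDr => //; rewrite ler_wpM2l // addr_ge0.
rewrite -W0 expr0n mulr0; apply/(@ler0_of_small _ _ C) => e e0.
pose L := Num.min e 1; have L0 : 0 < L by rewrite lt_min e0 /=.
have L1 : L <= 1 by rewrite ge_min lexx orbT.
apply: (@le_trans _ _ (C * L ^+ n.+1)).
  by apply: xL; [rewrite -W0 mulr0|apply: ler_wpDl].
rewrite mulrC; apply: ler_wpM2r => //; rewrite exprS.
apply: (@le_trans _ _ L); last by rewrite ge_min lexx.
by rewrite ler_piMr ?(ltW L0) // exprn_ile1 // ltW.
Qed.

Variables (g : F -> S) (p a b : R) (omega : R -> R -> R).
Variables (X : R -> R -> tens R V kappa.+1) (U : Type) (D : set U).
Variable zeta : R -> U -> block -> F.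
Hypotheses (g_smooth : frechet_smooth g) (om : control a b omega).
Hypothesis X_Cpow : Cpow p omega a b X.
Local Notation Om s t := (omega s t `^ p^-1).

(** The second variable is a spectator, in which the constants are uniform. The
    error has two parts: the remainder of [zeta] is moved through
    [faa_di_bruno_lipschitz], where every block is at most as long as [w], and
    the left multiplication by [X s t] through [shift_error_bound], applied to a
    horizontal curve that ends at [X s t]. *)
Lemma faa_di_bruno_remainder (Bd C1 : R) :
  0 < p -> 0 <= Bd ->
  (forall t u, level_vanishing (kappa := kappa) (zeta t u)) ->
  (forall t u, a <= t <= b -> D u -> forall b, `|zeta t u b| <= Bd) ->
  (forall b', exists K : set F, compact K /\
     forall t u, a <= t <= b -> D u -> K (zeta t u b')) ->
  (forall s t u v v', a <= s -> s <= t -> t <= b -> D u -> (size v < kappa)%N ->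
     `|zeta t u (v, v') - left_shift (X s t) (zeta s u) (v, v')| <=
       C1 * Om s t ^+ (kappa - size v)) ->
  forall w w', (size w < kappa)%N -> exists2 C : R, 0 <= C &
  forall s t u, a <= s -> s <= t -> t <= b -> D u ->
    `|faa_di_bruno g (zeta t u) w w' -
      pairing (X s t) (fun v =>
        cut_faa_di_bruno (kappa := kappa) g (zeta s u) w' (v ++ w))| <=
    C * Om s t ^+ (kappa - size w).
Proof.
move=> p0 Bd0 z0 zB /choice[K0 K0P] zR w w' wk.
have K0c b' : compact (K0 b') by case: (K0P b').
have K0z b' t u : a <= t <= b -> D u -> K0 b' (zeta t u b').
  by case: (K0P b') => _; exact.
have [c c0 hor] := Cpow_horizontal X_Cpow.
have [cc cc0 coefP] := @horizontal_coef_bound R V kappa.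
pose M := Om a b; have M0 : 0 <= M by exact: powR_ge0.
have OmM s t : a <= s -> s <= t -> t <= b -> 0 <= Om s t <= M.
  exact: control_pow_le.
(* The curves below have length at most [Lm] and coordinates at most [rho]. *)
pose Lm := (c + 1) * M + 1.
have Lm0 : 0 <= Lm by rewrite !(addr_ge0, mulr_ge0).
pose rho := (1 + cc * Lm) ^+ kappa.
have ccLm : 1 <= 1 + cc * Lm by rewrite lerDl mulr_ge0.
have rho1 : 1 <= rho by exact: exprn_ege1.
have rho0 : 0 <= rho by exact: le_trans rho1.
have horB L u (gamma : R -> tens R V kappa.+1) :
    L <= Lm -> horizontal_from1 L u gamma ->
    forall t, 0 <= t <= 1 -> forall v, `|gamma t v| <= rho.
  move=> LLm hg t t01 v; rewrite -coef_wseq.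
  apply: le_trans (coefP _ _ _ hg t t01 _) _.
  have L0 : 0 <= L.
    case: hg => _ _ uL; rewrite -lee_fin; apply: le_trans uL.
    exact: integral_ge0.
  apply: (@le_trans _ _ ((1 + cc * Lm) ^+ size (wseq v))).
    apply: lerXn2r; rewrite ?nnegrE ?mulr_ge0 ?(le_trans ler01 ccLm) //.
    apply: (@le_trans _ _ (cc * Lm)); first exact: ler_wpM2l.
    by rewrite lerDr.
  by apply: ler_weXn2l => //; rewrite -ltnS; exact: size_wseq.
(* [K1] contains the base points along the curves, and [K] the segments with
   end points in [K1]. *)
pose K1 := sum_set
  (fun v : word V kappa.+1 => dilate_set rho (K0 (wseq v, [::])))
  (index_enum _).
have K1c : compact K1 by apply: compact_sum_set => v; exact: compact_dilate_set.
have K1P (x : tens R V kappa.+1) t u : (forall v, `|x v| <= rho) ->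
    a <= t <= b -> D u -> K1 (left_shift x (zeta t u) empty_block).
  move=> xr tab Du; apply: sum_setP => v; apply: dilate_setP => //.
  by rewrite cats0; exact: K0z.
pose K := add_set K1 (dilate_set 1 (add_set K1 (dilate_set 1 K1))).
have Kc : compact K.
  by do !(apply: compact_add_set || apply: compact_dilate_set).
have KP x y (r : R) : K1 x -> K1 y -> 0 <= r <= 1 -> K (x + r *: (y - x)).
  move=> Kx Ky /andP[r0 r1]; apply: add_setP => //; apply: dilate_setP.
    by rewrite ger0_norm.
  by apply: add_setP => //; rewrite -scaleN1r; apply: dilate_setP;
    rewrite ?normrN1.
have [C2 C20 C2P] := @shift_error_bound R V F S kappa B g g_smooth
  K1 rho Bd K1c rho0 Bd0 (kappa - size w)%N w w' (subnKC (ltnW wk)).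
pose B1 := 1 + (#|{: word V kappa.+1}|%:R * (rho * Bd) *+ 2 + Bd).
have B11 : 1 <= B1 by rewrite lerDl addr_ge0 // mulrn_wge0 // !mulr_ge0.
have [C3 C30 C3P] := faa_di_bruno_lipschitz g_smooth Kc B11 w w'.
pose C4 := `|C1| * (1 + M) ^+ size w.
have C40 : 0 <= C4 by rewrite mulr_ge0 // exprn_ge0 // addr_ge0.
have [n wn] : exists n, (kappa - size w = n.+1)%N.
  by exists (kappa - size w).-1; rewrite prednK // subn_gt0.
exists (C3 * C4 + C2 * (c + 1) ^+ n.+1).
  by rewrite addr_ge0 // mulr_ge0 // exprn_ge0 // addr_ge0.
move=> s t u as_ st tb Du; rewrite wn.
have sab : a <= s <= b by rewrite as_ (le_trans st).
have tab : a <= t <= b by rewrite tb (le_trans as_).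
have Xr v : `|X s t v| <= rho.
  have [u' [gamma [hg <-]]] : exists u gamma,
      horizontal_from1 Lm u gamma /\ gamma 1 = X s t.
    apply: hor => //; rewrite /Lm -[ltLHS]addr0; apply: ler_ltD => //.
    have /andP[W0 WM] := OmM _ _ as_ st tb.
    by apply: ler_pM => //; rewrite lerDl.
  by apply: (horB Lm u') => //; rewrite ler01 lexx.
have shB b' : `|left_shift (X s t) (zeta s u) b'| <=
    #|{: word V kappa.+1}|%:R * (rho * Bd).
  by apply: pairing_bound => // v _; exact: zB.
rewrite mulrDl -[X in `|X|](subrKA
  (faa_di_bruno g (left_shift (X s t) (zeta s u)) w w')).
apply: le_trans (ler_normD _ _) _; apply: lerD.
- rewrite -mulrA; apply: C3P.
  + by rewrite mulr_ge0 // exprn_ge0 //; case/andP: (OmM _ _ as_ st tb).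
  + move=> [v v'] /= vw; apply: le_trans (zR _ _ _ _ _ as_ st tb Du _) _.
      exact: leq_ltn_trans wk.
    have /andP[W0 WM] := OmM _ _ as_ st tb.
    apply: (@le_trans _ _ (`|C1| * Om s t ^+ (kappa - size v))).
      by apply: ler_wpM2r (ler_norm _); exact: exprn_ge0.
    rewrite -mulrA; apply: ler_wpM2l => //.
    have -> : (kappa - size v = (size w - size v) + n.+1)%N.
      by rewrite -wn addnC addnBA // subnK // ltnW.
    rewrite exprD; apply: ler_wpM2r; first exact: exprn_ge0.
    apply: (@le_trans _ _ ((1 + M) ^+ (size w - size v))).
      by apply: lerXn2r; rewrite ?nnegrE ?addr_ge0 // ler_wpDl.
    by apply: ler_weXn2l; rewrite ?lerDl // leq_subr.
  + move=> r b' /andP[r0 r1].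
    have zB1 := zB _ _ tab Du b'; have shB1 := shB b'.
    apply: le_trans (ler_normD _ _) _; rewrite normrZ ger0_norm //.
    have nB1 := ler_normB (zeta t u b') (left_shift (X s t) (zeta s u) b').
    have := ler_wpM2r
      (normr_ge0 (zeta t u b' - left_shift (X s t) (zeta s u) b')) r1.
    by rewrite mul1r /B1 mulr2n; lra.
  + move=> r r01; apply: KP => //; first exact: K1P.
    have -> : zeta t u empty_block =
        left_shift (tone : tens R V kappa.+1) (zeta t u) empty_block.
      by rewrite /left_shift pairing_tword //; exact: left_shift_vanishing.
    apply: K1P => // v; rewrite ffunE; case: eqP => _;
      rewrite ?normr1 ?normr0 //.
- have [W0 WM] := (andP (OmM _ _ as_ st tb)).
  apply: (@power_bound_limit _ _ _ _ M) => //; first by rewrite W0.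
  move=> L cL LLm; have [u' [gamma [hg g1]]] := hor _ _ _ as_ st tb cL.
  have gB := horB _ _ _ LLm hg.
  rewrite -g1 -wn; apply: (C2P L u' gamma (zeta s u) hg gB) => //.
  + exact: zB.
  + by move=> r r01; apply: K1P => //; exact: gB.
  + by rewrite ler01 lexx.
Qed.

End OneSided.

(** * Increments and compactness of the values *)

Section Increments.
Context {R : realType} {V : finBanachType R} {kappa : nat}.
Variables (p a b : R) (omega : R -> R -> R) (X : R -> R -> tens R V kappa.+1).
Hypotheses (p_gt0 : 0 < p) (om : control a b omega).
Hypothesis (X_Cpow : Cpow p omega a b X).
Local Notation Om s t := (omega s t `^ p^-1).
Local Notation M := (Om a b).

(** Along a horizontal curve the coefficient of the empty word remains 1, and
    the others are at most of the order of the length. *)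
Lemma rough_coef_near1 : exists2 C : R, 0 <= C &
  forall s t, a <= s -> s <= t -> t <= b ->
  forall v, `|X s t v - (tone : tens R V kappa.+1) v| <= C * Om s t.
Proof.
have [c c0 hor] := Cpow_horizontal X_Cpow.
have [cc cc0 coefP] := @horizontal_coef_bound R V kappa.
pose y := cc * (c + 1); have y0 : 0 <= y by rewrite mulr_ge0 // addr_ge0.
have M0 : 0 <= M by exact: powR_ge0.
have C0 : 0 <= (1 + y * M) ^+ kappa * y.
  by rewrite mulr_ge0 // exprn_ge0 // addr_ge0 // mulr_ge0.
exists ((1 + y * M) ^+ kappa * y) => //.
move=> s t as_ st tb v; have /andP[W0 WM] := control_pow_le p_gt0 om as_ st tb.
have t1 : 0 <= (1 : R) <= 1 by rewrite ler01 lexx.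
rewrite ffunE; case: eqP => [v0|/eqP v0].
  have [|u [gamma [hg g1]]] := hor s t (c * Om s t + 1) as_ st tb;
    first by rewrite ltrDl.
  rewrite -coef_wseq v0 -g1 (horizontal_coef_nil hg t1) subrr normr0.
  exact: mulr_ge0.
rewrite subr0 -coef_wseq.
have [n wn] : exists n, size (wseq v) = n.+1.
  by case: (wseq v) v0 => // i w _; exists (size w).
have H : `|coef (X s t) (wseq v)| <=
    cc ^+ n.+1 * (c + 1) ^+ n.+1 * Om s t ^+ n.+1.
  apply: (@power_bound_limit _ _ _ _ _ M) => //; first exact: exprn_ge0.
    by rewrite W0.
  move=> L cL _; have [u [gamma [hg <-]]] := hor s t L as_ st tb cL.
  by have := coefP L u gamma hg 1 t1 (wseq v); rewrite wn exprMn.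
apply: le_trans H _; rewrite -!exprMn -/y exprSr -[leRHS]mulrA.
have yW : 0 <= y * Om s t by exact: mulr_ge0.
apply: ler_wpM2r => //; apply: (@le_trans _ _ ((1 + y * M) ^+ n)).
  have yM : 0 <= y * M by exact: mulr_ge0.
  apply: lerXn2r; rewrite ?nnegrE ?(addr_ge0 ler01 yM) //.
  by apply: (@le_trans _ _ (y * M)); [exact: ler_wpM2l|rewrite lerDr].
apply: ler_weXn2l; first by rewrite lerDl mulr_ge0.
by have := size_wseq v; rewrite wn !ltnS => /ltnW.
Qed.

Context {F : normedModType R} {B : eqType} {U : Type} (D : set U).
Variable zeta : R -> U -> seq (letter V) * seq B -> F.

Lemma controlled_increment (Bd C1 : R) : 0 <= Bd ->
  (forall t u, level_vanishing (kappa := kappa) (zeta t u)) ->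
  (forall s t u v v', a <= s -> s <= t -> t <= b -> D u -> (size v < kappa)%N ->
     `|zeta t u (v, v') - left_shift (X s t) (zeta s u) (v, v')| <=
       C1 * Om s t ^+ (kappa - size v)) ->
  exists2 C : R, 0 <= C &
  forall s t u, a <= s -> s <= t -> t <= b -> D u ->
    (forall b', `|zeta s u b'| <= Bd) ->
    forall b', `|zeta t u b' - zeta s u b'| <= C * Om s t.
Proof.
move=> Bd0 z0 zR; have [CX CX0 XP] := rough_coef_near1.
have M0 : 0 <= M by exact: powR_ge0.
exists (`|C1| * (1 + M) ^+ kappa + #|{: word V kappa.+1}|%:R * (CX * Bd)).
  by rewrite addr_ge0 // mulr_ge0 ?exprn_ge0 ?addr_ge0 // mulr_ge0.
move=> s t u as_ st tb Du zB [v v'].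
have /andP[W0 WM] := control_pow_le p_gt0 om as_ st tb.
have [kv|vk] := leqP kappa (size v).
  rewrite !z0 // subrr normr0 mulr_ge0 // addr_ge0 //.
    by rewrite mulr_ge0 ?exprn_ge0 ?addr_ge0.
  by rewrite !mulr_ge0.
rewrite -(subrKA (left_shift (X s t) (zeta s u) (v, v'))) mulrDl.
apply: le_trans (ler_normD _ _) _; apply: lerD.
  apply: le_trans (zR _ _ _ _ _ as_ st tb Du vk) _.
  have nE : (kappa - size v = (kappa - size v).-1.+1)%N.
    by rewrite prednK // subn_gt0.
  rewrite nE exprSr mulrA; apply: ler_wpM2r => //.
  apply: (@le_trans _ _ (`|C1| * Om s t ^+ (kappa - size v).-1)).
    by apply: ler_wpM2r (ler_norm _); exact: exprn_ge0.
  apply: ler_wpM2l => //.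
  apply: (@le_trans _ _ ((1 + M) ^+ (kappa - size v).-1)).
    by apply: lerXn2r; rewrite ?nnegrE ?addr_ge0 // ler_wpDl.
  apply: ler_weXn2l; first by rewrite lerDl.
  exact: leq_trans (leq_pred _) (leq_subr _ _).
have -> : left_shift (X s t) (zeta s u) (v, v') - zeta s u (v, v') =
    pairing (X s t - tone) (fun w => zeta s u (w ++ v, v')).
  have P := left_shift_vanishing (v, v') (z0 s u).
  have E : zeta s u (v, v') = pairing (tone : tens R V kappa.+1)
      (fun w => zeta s u (w ++ v, v')) by rewrite pairing_tword.
  rewrite [X in _ - X]E /left_shift /pairing -sumrB; apply: eq_bigr => w _.
  by rewrite -scalerBl !ffunE.
rewrite -mulrA mulrAC; apply: pairing_bound => //.
by move=> w; have := XP s t as_ st tb w; rewrite !ffunE.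
Qed.

End Increments.

Section CompactValues.
Context {R : realType}.

Lemma control_pow_small (a b p : R) omega t0 e : control a b omega -> 0 < p ->
  a <= t0 <= b -> 0 < e -> exists2 d : R, 0 < d &
  forall t, a <= t <= b -> `|t - t0| < d ->
    omega (Num.min t t0) (Num.max t t0) `^ p^-1 <= e.
Proof.
move=> [omc om0 _ omxx] p0 /andP[at0 t0b] e0.
set T := (X in {within X, continuous _}) in omc.
have Tt0 : T (t0, t0) by split=> //=; split.
have /cvgrPdist_lt/(_ (e `^ p) (powR_gt0 _ e0)) near0 :=
  (subspace_continuousP _ _).1 omc _ Tt0.
have om00 : omega t0 t0 = 0 by exact: omxx.
have : \forall x \near within T (nbhs (t0, t0)),
    `|omega t0 t0 - omega x.1 x.2| < e `^ p by exact: near0.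
rewrite om00 => -[[A A'] /= [+ +] AA'].
move=> /nbhs_ballP[d1 d10 d1A] /nbhs_ballP[d2 d20 d2A'].
exists (Num.min d1 d2); first by rewrite lt_min; apply/andP; split.
move=> t /andP[at_ tb]; rewrite lt_min => /andP[td1 td2].
have near1 : ball t0 d1 (Num.min t t0).
  rewrite -ball_normE /= distrC; case: (leP t t0) => // _.
  by rewrite subrr normr0.
have near2 : ball t0 d2 (Num.max t t0).
  rewrite -ball_normE /= distrC; case: (leP t t0) => // _.
  by rewrite subrr normr0.
have Tm : T (Num.min t t0, Num.max t t0).
  rewrite /T /= le_min at_ at0; split=> //; split; last by rewrite ge_max tb.
  by rewrite ge_min !le_max lexx.
have := AA' (Num.min t t0, Num.max t t0) (conj (d1A _ near1) (d2A' _ near2)) Tm.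
rewrite /= sub0r normrN; case: Tm => Tm1 [Tm2 Tm3].
have w0 := om0 _ _ Tm1 Tm2 Tm3; rewrite ger0_norm // => we.
have -> : e = (e `^ p) `^ p^-1.
  by rewrite -powRrM mulfV ?gt_eqF // powRr1 // ltW.
apply: ge0_ler_powR; rewrite ?nnegrE ?invr_ge0 ?powR_ge0 //; exact: ltW.
Qed.

(** The controls are moduli of continuity, so that the image of the rectangle is
    compact. *)
Lemma compact_values (F : normedModType R) (a b c d p q C C' : R)
    (om om' : R -> R -> R) (f : R -> R -> F) :
  control a b om -> control c d om' -> 0 < p -> 0 < q -> 0 <= C -> 0 <= C' ->
  (forall s t u, a <= s -> s <= t -> t <= b -> c <= u <= d ->
     `|f t u - f s u| <= C * om s t `^ p^-1) ->
  (forall u v s, c <= u -> u <= v -> v <= d -> a <= s <= b ->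
     `|f s v - f s u| <= C' * om' u v `^ q^-1) ->
  exists K : set F, compact K /\
    forall t u, a <= t <= b -> c <= u <= d -> K (f t u).
Proof.
move=> omP omP' p0 q0 C0 C'0 fC fC'.
pose box : set (R * R) := `[a, b] `*` `[c, d].
exists ((fun x => f x.1 x.2) @` box); split; last first.
  by move=> t u tab ucd; exists (t, u) => //; split; rewrite /= in_itv.
apply: continuous_compact; last by apply: compact_setX; exact: segment_compact.
apply/subspace_continuousP => -[t0 u0] [/=]; rewrite !in_itv /= => t0ab u0cd.
apply/cvgrPdist_le => e e0 /=.
have e1 : 0 < e / (2 * (C + 1)) by rewrite divr_gt0 // mulr_gt0 // ltr_wpDl.
have e2 : 0 < e / (2 * (C' + 1)) by rewrite divr_gt0 // mulr_gt0 // ltr_wpDl.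
have [d1 d10 d1P] := control_pow_small omP p0 t0ab e1.
have [d2 d20 d2P] := control_pow_small omP' q0 u0cd e2.
have small (k x : R) : 0 <= k -> x <= e / (2 * (k + 1)) -> k * x <= e / 2.
  move=> k0 xe; apply: (le_trans (ler_wpM2l k0 xe)).
  have k1 : 0 < k + 1 by rewrite ltr_wpDl.
  have -> : k * (e / (2 * (k + 1))) = e / 2 * (k / (k + 1)).
    by field; rewrite gt_eqF.
  by rewrite ler_piMr ?divr_ge0 ?(ltW e0) // ler_pdivrMr // mul1r lerDl.
exists (ball t0 d1, ball u0 d2); first by split; exact: nbhsx_ballx.
move=> [t u] [/= td ud] [/=]; rewrite !in_itv /= => tab ucd.
move: td ud; rewrite -!ball_normE /= => td ud.
rewrite [e]splitr -(subrKA (f t u0)); apply: le_trans (ler_normD _ _) _.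
have td' := d1P t tab; have ud' := d2P u ucd.
rewrite distrC in td; rewrite distrC in ud.
have {}td' := small _ _ C0 (td' td); have {}ud' := small _ _ C'0 (ud' ud).
case/andP: (tab) => at_ tb; case/andP: (t0ab) => at0 t0b.
case/andP: (ucd) => cu ud0; case/andP: (u0cd) => cu0 u0d.
apply: lerD.
  apply: le_trans td'; case: (leP t t0) => tt0; first exact: fC.
  by rewrite distrC; apply: fC => //; exact: ltW.
apply: le_trans ud'; case: (leP u u0) => uu0; first exact: fC'.
by rewrite distrC; apply: fC' => //; exact: ltW.
Qed.

End CompactValues.

(** * Projective norms and basis words *)

Section ProjectiveNorm.
Context {R : realType} {V : finBanachType R}.
Local Notation e := (vbasis (@fullv _ V)).

Lemma pure_tensor_basis j (w : j.-tuple (letter V)) :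
  pure_tensor (fun l => e`_(tnth w l)) =
  [ffun w' => (w' == w)%:R] :> tpow R V j.
Proof.
apply/ffunP => w'; rewrite !ffunE.
rewrite (eq_bigr (fun l => (tnth w' l == tnth w l)%:R : R)); last first.
  move=> l _; rewrite coord_free ?(basis_free (vbasisP _)) // eq_sym.
  by [].
case: eqP => [->|ww']; first by rewrite big1 // => l _; rewrite eqxx.
have [l lP] : exists l, tnth w' l != tnth w l.
  apply/existsP; apply: contraT; rewrite negb_exists => /forallP H.
  by case: ww'; apply: eq_from_tnth => l; apply/eqP; move: (H l); rewrite negbK.
by rewrite (bigD1 l) //= (negbTE lP) mul0r.
Qed.

Lemma tpow_representation j (x : tpow R V j) :
  exists m (c : 'I_m -> R) (v : 'I_m -> 'I_j -> V),
    x = \sum_i c i *: pure_tensor (v i).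
Proof.
pose T := j.-tuple (letter V).
exists #|[pred w : T | true]|, (fun i => x (enum_val i)).
exists (fun i (l : 'I_j) => e`_(tnth (enum_val i : T) l)).
under eq_bigr do rewrite pure_tensor_basis.
rewrite -(big_enum_val (A := [pred w : T | true])
  (fun w => x w *: ([ffun w' => (w' == w)%:R] : tpow R V j))).
apply/ffunP => w; rewrite sum_ffunE (bigD1 w) //= !ffunE eqxx [_ *: _]mulr1.
rewrite big1 ?addr0 // => w' /negbTE ww'.
by rewrite !ffunE eq_sym ww' scaler0.
Qed.

Lemma projnorm_ge (x r : R) j (t : tpow R V j) :
  (forall m (c : 'I_m -> R) (v : 'I_m -> 'I_j -> V),
    t = \sum_i c i *: pure_tensor (v i) ->
    x <= \sum_i `|c i| * \prod_l `|v i l|) -> x <= projnorm t.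
Proof.
move=> H; apply: lb_le_inf.
  have [m [c [v tE]]] := tpow_representation t.
  by exists (\sum_i `|c i| * \prod_l `|v i l|), m, c, v.
by move=> _ [m [c [v [tE ->]]]]; exact: H.
Qed.

Lemma projnorm_ge0 j (t : tpow R V j) : 0 <= projnorm t.
Proof.
apply: (projnorm_ge 0) => m c v _; apply: sumr_ge0 => i _.
by apply: mulr_ge0 => //; exact: prodr_ge0.
Qed.

Lemma projnorm_coord (k : R) j (t : tpow R V j) w : 0 < k ->
  (forall i (v : V), `|coord e i v| <= k * `|v|) ->
  `|t w| <= k ^+ j * projnorm t.
Proof.
move=> k0 kP; have kj : 0 < k ^+ j by exact: exprn_gt0.
rewrite -ler_pdivrMl //; apply: (projnorm_ge 0) => m c v ->.
rewrite ler_pdivrMl // sum_ffunE; apply: le_trans (ler_norm_sum _ _ _) _.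
rewrite mulr_sumr; apply: ler_sum => i _; rewrite !ffunE normrZ mulrCA.
apply: ler_wpM2l => //; rewrite normr_prod.
have -> : k ^+ j = \prod_(l < j) k by rewrite prodr_const card_ord.
rewrite -big_split /=; apply: ler_prod => l _.
by rewrite normr_ge0 kP.
Qed.

Lemma inlevel_coef N j (t : tpow R V j) (u : word V N)
    (uj : size (wseq u) == j) :
  (inlevel t : tens R V N) u = t (Tuple uj).
Proof. by rewrite ffunE (big_pred1 (Tuple uj)). Qed.

Lemma inlevel_neq N j (t : tpow R V j) (u : word V N) :
  size (wseq u) != j -> (inlevel t : tens R V N) u = 0.
Proof.
move=> uj; rewrite ffunE big_pred0 // => w; apply: contraNF uj => /eqP <-.
by rewrite size_tuple.
Qed.

Lemma inlevel_delta N v :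
  inlevel [ffun w : (size v).-tuple (letter V) => (tval w == v)%:R] =
  tword v :> tens R V N.
Proof.
apply/ffunP => u; have [uv|uv] := boolP (size (wseq u) == size v).
  by rewrite inlevel_coef !ffunE.
rewrite inlevel_neq // ffunE; case: eqP => // uv'.
by move: uv; rewrite uv' eqxx.
Qed.

Lemma coef_norm_bounds N : exists2 k : R, 0 <= k &
  (forall j (t : tpow R V j) u, (j < N)%N ->
     `|(inlevel t : tens R V N) u| <= k * projnorm t) /\
  (forall (x : tens R V N) u, `|x u| <= k * tnorm x).
Proof.
have [k k0 kP] := @coord_bounded R V.
have pow_le j (t : tpow R V j) w : (j < N)%N ->
    `|t w| <= (1 + k) ^+ N * projnorm t.
  move=> jN; apply: le_trans (projnorm_coord _ _ k0 kP) _.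
  apply: ler_wpM2r; first exact: projnorm_ge0.
  apply: (@le_trans _ _ ((1 + k) ^+ j)).
    by apply: lerXn2r; rewrite ?nnegrE ?addr_ge0 ?(ltW k0) // lerDr.
  by apply: ler_weXn2l; [rewrite lerDl ltW|exact: ltnW].
exists ((1 + k) ^+ N); first by rewrite exprn_ge0 // addr_ge0 // ltW.
split=> [j t u jN|x u].
  have [uj|uj] := boolP (size (wseq u) == j); last first.
    rewrite inlevel_neq // normr0 mulr_ge0 ?projnorm_ge0 // exprn_ge0 //.
    by rewrite addr_ge0 // ltW.
  by rewrite inlevel_coef; exact: pow_le.
pose j := Ordinal (size_wseq u).
have -> : x u = (level j x) (in_tuple (wseq u)) by rewrite ffunE coef_wseq.
apply: le_trans (pow_le _ _ _ (size_wseq u)) _; apply: ler_wpM2l.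
  by rewrite exprn_ge0 // addr_ge0 // ltW.
rewrite /tnorm (bigD1 j) //= lerDl; apply: sumr_ge0 => i _.
exact: projnorm_ge0.
Qed.

End ProjectiveNorm.

Section BoxBounds.
Context {R : realType} {V W : finBanachType R} {kappa lambda : nat}.
Context {F : normedModType R}.
Local Notation TT := (tens2 R V kappa W lambda).

Lemma boxmap_linear f h : linear (@boxmap R V W kappa lambda f h).
Proof.
move=> c A B; rewrite /boxmap scaler_sumr -big_split /=.
by apply: eq_bigr => w _; rewrite !ffunE scalerDl scalerA.
Qed.

Lemma remainder_linear (z z' : {linear TT -> F}) f h :
  linear (fun A => z A - z' (boxmap f h A)).
Proof.
move=> c A B; rewrite boxmap_linear [z _]linearP [z' _]linearP opprD addrACA.
by rewrite -scalerBr.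
Qed.

Lemma box_bound (L : TT -> F) (x : tens R V kappa) (y : tens R W lambda)
    (C : word V kappa -> word W lambda -> R) P ax ay :
  linear L -> 0 <= P -> (forall u u', 0 <= C u u') ->
  (forall u, `|x u| <= ax) -> (forall u', `|y u'| <= ay) ->
  (forall u u', x u != 0 -> y u' != 0 ->
     `|L (box (tword (wseq u)) (tword (wseq u')))| <= C u u' * P) ->
  `|L (box x y)| <= (\sum_u \sum_u' C u u') * P * (ax * ay).
Proof.
move=> Llin P0 C0 xa ya LC.
pose L' : {linear TT -> F} :=
  HB.pack L (GRing.isLinear.Build R TT F *:%R L Llin).
rewrite -[L _]/(L' _) eval_box -mulrA mulr_suml.
apply: le_trans (ler_norm_sum _ _ _) _; apply: ler_sum => u _.
rewrite mulr_suml; apply: le_trans (ler_norm_sum _ _ _) _.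
apply: ler_sum => u' _; rewrite normrZ.
have a0 : 0 <= ax * ay.
  by apply: mulr_ge0; [exact: le_trans (xa u)|exact: le_trans (ya u')].
have Ca0 : 0 <= C u u' * (P * (ax * ay)) by do 2!apply: mulr_ge0 => //.
have [x0|x0] := eqVneq (x u) 0; first by rewrite x0 mul0r normr0 mul0r.
have [y0|y0] := eqVneq (y u') 0; first by rewrite y0 mulr0 normr0 mul0r.
rewrite mulrA mulrC; apply: ler_pM => //; first exact: LC.
by rewrite normrM; apply: ler_pM.
Qed.

End BoxBounds.

Lemma powR_level (R : realType) (x p : R) n j : 0 <= x -> (j <= n)%N ->
  x `^ ((n%:R - j%:R) / p) = x `^ p^-1 ^+ (n - j).
Proof.
by move=> x0 jn; rewrite -natrB // mulrC powRrM powR_mulrn // powR_ge0.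
Qed.

Section ComposeWord.
Context {R : realType} {V W : finBanachType R} {kappa lambda : nat}.
Context {F : normedModType R} {S : finBanachType R}.
Local Notation TT := (tens2 R V kappa W lambda).
Variable g : F -> S.
Hypothesis g_smooth : frechet_smooth g.

Lemma frechet_map_invariant (T : eqType) (f : T -> F) x :
  perm_invariant (fun pi : seq T => frechet g [seq f b | b <- pi] x).
Proof. by move=> s t st; rewrite (frechet_perm g_smooth (perm_map f st)). Qed.

Lemma rcoprod2_iter0 (A B : Type) (w : seq A) (w' : seq B) :
  ~~ (nilp w && nilp w') -> rcoprod2_iter 0 w w' = [::].
Proof.
by rewrite /rcoprod2_iter /=; case: w => [|i w]; case: w' => [|j w'].
Qed.

Lemma sum_rcoprod2_nilr (A B : eqType) (U : nmodType) m (w : seq A)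
    (f : seq (seq A * seq B) -> U) :
  \sum_(t <- rcoprod2_iter m w [::]) f t =
  \sum_(t <- rcoprod_iter m w) f [seq (u, [::]) | u <- t].
Proof.
rewrite sum_rcoprod2_iter /coprod2_sum /rcoprod_iter big_filter [RHS]big_mkcond.
rewrite coprod_iter_nil.
apply: (eq_big_all (size_coprod_iter m w)) => x /eqP <-.
rewrite big_seq1.
have -> : zip x (nseq (size x) [::]) =
    [seq (u, [::]) | u <- x] :> seq (seq A * seq B).
  by elim: x => //= u x ->.
rewrite all_map (eq_all (a2 := fun u => ~~ nilp u)) // => u /=.
by rewrite andbT.
Qed.

Lemma sum_rcoprod2_nill (A B : eqType) (U : nmodType) m (w' : seq B)
    (f : seq (seq A * seq B) -> U) :
  \sum_(t <- rcoprod2_iter m [::] w') f t =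
  \sum_(t <- rcoprod_iter m w') f [seq ([::], u) | u <- t].
Proof.
rewrite sum_rcoprod2_swap sum_rcoprod2_nilr; apply: eq_bigr => t _.
by rewrite -map_comp.
Qed.

(** The sums of [compose_word] run up to the largest possible number of blocks,
    in each of the three cases. *)
Lemma compose_wordE (z : {linear TT -> F}) w w' :
  (size w < kappa)%N -> (size w' < lambda)%N ->
  compose_word g z w w' = faa_di_bruno g (word_eval z) w w'.
Proof.
move=> wk wl.
have zP := @frechet_map_invariant _ (word_eval z) (word_eval z empty_block).
have main M : (size w + size w' < M)%N -> ~~ (nilp w && nilp w') ->
    \sum_(1 <= m < M) ((m`!)%:R : R)^-1 *:
      \sum_(t <- rcoprod2_iter m w w')
        frechet g [seq word_eval z b | b <- t] (word_eval z empty_block) =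
    faa_di_bruno g (word_eval z) w w'.
  move=> ltM ne; rewrite -[RHS](weighted_rcoprod2_partitions (R := R) zP ltM).
  rewrite [RHS]big_ltn; last exact: leq_ltn_trans ltM.
  by rewrite rcoprod2_iter0 // big_nil scaler0 add0r.
case: w w' wk wl main => [|i w] [|j w'] wk wl main.
- by rewrite /faa_di_bruno big_seq1.
- rewrite -(main lambda) //; apply: eq_bigr => m _; congr (_ *: _).
  rewrite sum_rcoprod2_nill; apply: eq_bigr => t _.
  by rewrite -map_comp.
- rewrite -(main kappa) //; last by rewrite addn0.
  apply: eq_bigr => m _; congr (_ *: _).
  rewrite sum_rcoprod2_nilr; apply: eq_bigr => t _.
  by rewrite -map_comp.
- rewrite -(main (lambda + kappa - 2).+1) //.
  by move: wk wl => /=; lia.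
Qed.

Lemma word_eval_compose (z : {linear TT -> F}) w w' : (size w' < lambda)%N ->
  word_eval (compose_ctrl g z : {linear TT -> S}) (w, w') =
  cut_faa_di_bruno (kappa := kappa) g (word_eval z) w' w.
Proof.
move=> wl; rewrite /cut_faa_di_bruno; case: ltnP => wk;
  last exact: word_eval_longl.
rewrite -compose_wordE //.
transitivity (compose_ctrl g z (box (tword w) (tword w'))); first by [].
rewrite /compose_ctrl.
have [u uw] := word_of_seq wk; have [u' uw'] := word_of_seq wl.
rewrite (bigD1 (u, u')) //= !ffunE uw uw' !eqxx mulr1 scale1r.
rewrite big1 ?addr0 // => -[v v']; rewrite xpair_eqE !ffunE -uw -uw'.
rewrite !(inj_eq (@wseq_inj _ _ _)) -natrM mulnb => /negbTE ->.
by rewrite scale0r.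
Qed.

Definition swap_block {A B : Type} (b : seq B * seq A) : seq A * seq B :=
  (b.2, b.1).

Lemma faa_di_bruno_swap (A B : eqType) (zeta : seq A * seq B -> F) w w' :
  faa_di_bruno g (zeta \o swap_block) w' w = faa_di_bruno g zeta w w'.
Proof.
rewrite /faa_di_bruno (sum_partitions_swap (R := R));
  last exact: frechet_map_invariant.
apply: eq_bigr => pi _; rewrite -map_comp; congr (frechet g _ _).
by apply: eq_map => -[].
Qed.

Lemma word_eval_compose_swap (z : {linear TT -> F}) w w' : (size w < kappa)%N ->
  word_eval (compose_ctrl g z : {linear TT -> S}) (w, w') =
  cut_faa_di_bruno (kappa := lambda) g (word_eval z \o swap_block) w w'.
Proof.
move=> wk; rewrite /cut_faa_di_bruno; case: ltnP => wl;
  last exact: word_eval_longr.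
by rewrite word_eval_compose // /cut_faa_di_bruno wk faa_di_bruno_swap.
Qed.

End ComposeWord.

(** * The estimate in two parameters *)

Section WordRemainders.
Context {R : realType} {V W : finBanachType R} {kappa lambda : nat}.
Context {F : normedModType R}.
Local Notation TT := (tens2 R V kappa W lambda).

Lemma sum2_ge_term (I J : finType) (f : I -> J -> R) i j :
  (forall i j, 0 <= f i j) -> f i j <= \sum_i \sum_j f i j.
Proof.
move=> f0; rewrite (bigD1 i) //= (bigD1 j) //= -addrA lerDl addr_ge0 //.
  exact: sumr_ge0.
by apply: sumr_ge0 => i' _; exact: sumr_ge0.
Qed.

Lemma word_eval_bounded (z : {linear TT -> F}) :
  exists2 C : R, 0 <= C & forall b, `|word_eval z b| <= C.
Proof.
have ge0 (u : word V kappa) (u' : word W lambda) :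
  0 <= `|word_eval z (wseq u, wseq u')| by [].
exists (\sum_(u : word V kappa) \sum_(u' : word W lambda)
    `|word_eval z (wseq u, wseq u')|).
  by apply: sumr_ge0 => u _; apply: sumr_ge0.
move=> [v v']; have [vk|kv] := ltnP (size v) kappa; last first.
  by rewrite word_eval_longl // normr0; apply: sumr_ge0 => u _; apply: sumr_ge0.
have [vl|lv] := ltnP (size v') lambda; last first.
  by rewrite word_eval_longr // normr0; apply: sumr_ge0 => u _; apply: sumr_ge0.
have [u <-] := word_of_seq vk; have [u' <-] := word_of_seq vl.
exact: (sum2_ge_term u u' ge0).
Qed.

Variables (p q a b c d : R) (omegaX omegaY : R -> R -> R).
Variables (X : R -> R -> tens R V kappa.+1) (Y : R -> R -> tens R W lambda.+1).
Hypotheses (omX : control a b omegaX) (omY : control c d omegaY).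
Variable Z : R -> R -> {linear TT -> F}.
Hypothesis ZP : controlled2 p q omegaX omegaY a b c d X Y Z.

Lemma word_remainder1 : exists C : R, forall s t u v v',
  a <= s -> s <= t -> t <= b -> c <= u <= d -> (size v < kappa)%N ->
  `|word_eval (Z t u) (v, v') -
    left_shift (X s t) (word_eval (Z s u)) (v, v')| <=
  C * omegaX s t `^ p^-1 ^+ (kappa - size v).
Proof.
have [[C CP] _] := ZP.
pose delta (w : seq (letter V)) : tpow R V (size w) :=
  [ffun w' => (tval w' == w)%:R].
pose f (u : word V kappa) (u' : word W lambda) : R :=
  `|C * projnorm (delta (wseq u)) * tnorm (tword (wseq u') : tens R W lambda)|.
have f0 u u' : 0 <= f u u' by exact: normr_ge0.
exists (\sum_u \sum_u' f u u') => s t u v v' as_ st tb /andP[cu ud] vk.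
have O0 : 0 <= omegaX s t by case: omX => _ H _ _; exact: H.
have [vl|lv] := ltnP (size v') lambda; last first.
  rewrite word_eval_longr // /left_shift /pairing big1 ?subrr ?normr0.
    apply: mulr_ge0; first by apply: sumr_ge0 => ? _; apply: sumr_ge0.
    by rewrite exprn_ge0 // powR_ge0.
  by move=> w _; rewrite word_eval_longr // scaler0.
have := CP s t u as_ st tb cu ud _ (delta v) (tword v') vk.
rewrite inlevel_delta rem1_tword // powR_level // ?(ltnW vk) //.
move=> H; apply: le_trans H _.
have swap (x1 x2 x3 x4 : R) : x1 * x2 * x3 * x4 = x1 * x3 * x4 * x2 by ring.
rewrite swap; apply: ler_wpM2r; first by rewrite exprn_ge0 // powR_ge0.
have [w wv] := word_of_seq vk; have [w' wv'] := word_of_seq vl.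
by apply: le_trans (sum2_ge_term w w' f0); rewrite /f wv wv'; exact: ler_norm.
Qed.

Lemma word_remainder2 : exists C : R, forall s t u v v',
  c <= s -> s <= t -> t <= d -> a <= u <= b -> (size v < lambda)%N ->
  `|(word_eval (Z u t) \o swap_block) (v, v') -
    left_shift (Y s t) (word_eval (Z u s) \o swap_block) (v, v')| <=
  C * omegaY s t `^ q^-1 ^+ (lambda - size v).
Proof.
have [_ [C CP]] := ZP.
pose delta (w : seq (letter W)) : tpow R W (size w) :=
  [ffun w' => (tval w' == w)%:R].
pose f (u : word V kappa) (u' : word W lambda) : R :=
  `|C * tnorm (tword (wseq u) : tens R V kappa) * projnorm (delta (wseq u'))|.
have f0 u u' : 0 <= f u u' by exact: normr_ge0.
exists (\sum_u \sum_u' f u u') => s t u v v' cs st td /andP[au ub] vl.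
have O0 : 0 <= omegaY s t by case: omY => _ H _ _; exact: H.
have [vk|kv] := ltnP (size v') kappa; last first.
  rewrite /= word_eval_longl // /left_shift /pairing big1 ?subrr ?normr0.
    apply: mulr_ge0; first by apply: sumr_ge0 => ? _; apply: sumr_ge0.
    by rewrite exprn_ge0 // powR_ge0.
  by move=> w _; rewrite /= word_eval_longl // scaler0.
have := CP s t u cs st td au ub _ (tword v') (delta v) vl.
rewrite inlevel_delta rem2_tword // powR_level // ?(ltnW vl) //.
move=> H; apply: le_trans H _.
have swap (x1 x2 x3 x4 : R) : x1 * x2 * x3 * x4 = x1 * x3 * x4 * x2 by ring.
rewrite swap; apply: ler_wpM2r; first by rewrite exprn_ge0 // powR_ge0.
have [w wv] := word_of_seq vk; have [w' wv'] := word_of_seq vl.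
by apply: le_trans (sum2_ge_term w w' f0); rewrite /f wv wv'; exact: ler_norm.
Qed.

End WordRemainders.

Section ControlledOfWords.
Context {R : realType} {V W : finBanachType R} {kappa lambda : nat}.
Context {S : normedModType R}.
Local Notation TT := (tens2 R V kappa W lambda).
Variables (p q a b c d : R) (omegaX omegaY : R -> R -> R).
Variables (X : R -> R -> tens R V kappa.+1) (Y : R -> R -> tens R W lambda.+1).
Hypotheses (omX : control a b omegaX) (omY : control c d omegaY).
Variable Z : R -> R -> {linear TT -> S}.

Lemma choice_words (P : word V kappa -> word W lambda -> R -> Prop) :
  (forall w w', exists2 C : R, 0 <= C & P w w' C) ->
  exists f : word V kappa -> word W lambda -> R,
    (forall w w', 0 <= f w w') /\ (forall w w', P w w' (f w w')).
Proof.
move=> H; have /choice[f fP] : forall x : word V kappa * word W lambda,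
    exists C : R, 0 <= C /\ P x.1 x.2 C.
  by move=> [w w']; have [C C0 CP] := H w w'; exists C.
by exists (fun w w' => f (w, w')); split=> w w'; have [] := fP (w, w').
Qed.

(** By finite dimension the estimates on pairs of basis words are enough. *)
Lemma controlled2_of_words :
  (forall (w : word V kappa) (w' : word W lambda), exists2 C : R, 0 <= C &
     forall s t u, a <= s -> s <= t -> t <= b -> c <= u <= d ->
     `|rem1 X Z s t u (box (tword (wseq w)) (tword (wseq w')))| <=
       C * omegaX s t `^ p^-1 ^+ (kappa - size (wseq w))) ->
  (forall (w : word V kappa) (w' : word W lambda), exists2 C : R, 0 <= C &
     forall s t u, c <= s -> s <= t -> t <= d -> a <= u <= b ->
     `|rem2 Y Z s t u (box (tword (wseq w)) (tword (wseq w')))| <=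
       C * omegaY s t `^ q^-1 ^+ (lambda - size (wseq w'))) ->
  controlled2 p q omegaX omegaY a b c d X Y Z.
Proof.
have [kV kV0 [kV1 kV2]] := @coef_norm_bounds R V kappa.
have [kW kW0 [kW1 kW2]] := @coef_norm_bounds R W lambda.
move=> /choice_words[f1 [f10 f1P]] /choice_words[f2 [f20 f2P]]; split.
  exists ((\sum_w \sum_w' f1 w w') * (kV * kW)).
  move=> s t u as_ st tb cu ud j eta xi jk.
  have O0 : 0 <= omegaX s t by case: omX => _ H _ _; exact: H.
  rewrite powR_level // ?(ltnW jk) //.
  apply: le_trans (@box_bound _ _ _ _ _ _ _ _ _ f1
    (omegaX s t `^ p^-1 ^+ (kappa - j)) (kV * projnorm eta) (kW * tnorm xi)
    (@remainder_linear _ _ _ _ _ _ _ _ _ _) _ f10 _ _ _) _.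
  - by rewrite exprn_ge0 // powR_ge0.
  - by move=> w; exact: kV1.
  - exact: kW2.
  - move=> w w' eta_w _.
    have <- : size (wseq w) = j.
      by apply/eqP; apply: contraNT eta_w => wj; rewrite inlevel_neq.
    by apply: f1P; rewrite ?cu ?ud.
  - by rewrite le_eqVlt; apply/orP; left; apply/eqP; ring.
exists ((\sum_w \sum_w' f2 w w') * (kV * kW)).
move=> u v s cu uv vd as_ sb k eta xi kl.
have O0 : 0 <= omegaY u v by case: omY => _ H _ _; exact: H.
rewrite powR_level // ?(ltnW kl) //.
apply: le_trans (@box_bound _ _ _ _ _ _ _ _ _ f2
  (omegaY u v `^ q^-1 ^+ (lambda - k)) (kV * tnorm eta) (kW * projnorm xi)
  (@remainder_linear _ _ _ _ _ _ _ _ _ _) _ f20 _ _ _) _.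
- by rewrite exprn_ge0 // powR_ge0.
- exact: kV2.
- by move=> w; exact: kW1.
- move=> w w' _ xi_w.
  have <- : size (wseq w') = k.
    by apply/eqP; apply: contraNT xi_w => wj; rewrite inlevel_neq.
  by apply: f2P; rewrite ?as_ ?sb.
- by rewrite le_eqVlt; apply/orP; left; apply/eqP; ring.
Qed.

End ControlledOfWords.

Section Regularity.
Context {R : realType} {V W : finBanachType R} {kappa lambda : nat}.
Context {F : normedModType R}.
Local Notation TT := (tens2 R V kappa W lambda).
Variables (p q a b c d : R) (omegaX omegaY : R -> R -> R).
Variables (X : R -> R -> tens R V kappa.+1) (Y : R -> R -> tens R W lambda.+1).
Hypotheses (p_gt0 : 0 < p) (q_gt0 : 0 < q) (le_ab : a <= b).
Hypotheses (omX : control a b omegaX) (omY : control c d omegaY).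
Hypotheses (X_Cpow : Cpow p omegaX a b X) (Y_Cpow : Cpow q omegaY c d Y).
Variable Z : R -> R -> {linear TT -> F}.
Hypothesis ZP : controlled2 p q omegaX omegaY a b c d X Y Z.

(** Boundedness propagates from the corner [(a, c)] first along the edge
    [s = a] and then across the rectangle. *)
Lemma controlled_bounded_compact : exists2 Bd : R, 0 <= Bd &
  (forall t u b', a <= t <= b -> c <= u <= d ->
     `|word_eval (Z t u) b'| <= Bd) /\
  (forall b', exists K : set F, compact K /\
     forall t u, a <= t <= b -> c <= u <= d -> K (word_eval (Z t u) b')).
Proof.
have [C1 C1P] := word_remainder1 omX ZP.
have [C2 C2P] := word_remainder2 omY ZP.
have z1 t u : level_vanishing (kappa := kappa) (word_eval (Z t u)).
  by move=> v v'; exact: word_eval_longl.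
have z2 t u :
    level_vanishing (kappa := lambda) (word_eval (Z u t) \o swap_block).
  by move=> v v'; exact: word_eval_longr.
have inc1 Bd (Bd0 : 0 <= Bd) := controlled_increment p_gt0 omX X_Cpow
  (D := [set u | c <= u <= d]) Bd0 z1 C1P.
have inc2 Bd (Bd0 : 0 <= Bd) := controlled_increment q_gt0 omY Y_Cpow
  (D := [set u | a <= u <= b]) Bd0 z2 C2P.
have [B0 B00 B0P] := word_eval_bounded (Z a c).
have [D1 D10 D1P] := inc2 B0 B00.
pose B1 := B0 + D1 * omegaY c d `^ q^-1.
have B10 : 0 <= B1 by rewrite addr_ge0 // mulr_ge0 // powR_ge0.
have B1P u b' : c <= u <= d -> `|word_eval (Z a u) b'| <= B1.
  move=> /andP[cu ud]; have := D1P c u a (lexx c) cu ud _ _ (swap_block b').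
  rewrite /= lexx le_ab => /(_ isT (fun b' => B0P _)).
  have /andP[_ WM] := control_pow_le q_gt0 omY (lexx c) cu ud.
  have -> : swap_block (swap_block b') = b' by case: b'.
  move=> H; rewrite -[word_eval (Z a u) b'](subrK (word_eval (Z a c) b')).
  apply: le_trans (ler_normD _ _) _; rewrite addrC; apply: lerD => //.
  by apply: le_trans H _; exact: ler_wpM2l.
have [D2 D20 D2P] := inc1 B1 B10.
pose Bd := B1 + D2 * omegaX a b `^ p^-1.
have Bd0 : 0 <= Bd by rewrite addr_ge0 // mulr_ge0 // powR_ge0.
have BdP t u b' : a <= t <= b -> c <= u <= d -> `|word_eval (Z t u) b'| <= Bd.
  move=> /andP[at_ tb] ucd.
  have := D2P a t u (lexx a) at_ tb ucd (fun b' => B1P u b' ucd) b'.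
  have /andP[_ WM] := control_pow_le p_gt0 omX (lexx a) at_ tb.
  move=> H; rewrite -[word_eval (Z t u) b'](subrK (word_eval (Z a u) b')).
  apply: le_trans (ler_normD _ _) _; rewrite addrC; apply: lerD;
    first exact: B1P.
  by apply: le_trans H _; exact: ler_wpM2l.
exists Bd => //; split=> // b'.
have [D3 D30 D3P] := inc1 Bd Bd0; have [D4 D40 D4P] := inc2 Bd Bd0.
apply: (compact_values (p := p) (q := q) omX omY p_gt0 q_gt0 D30 D40).
  move=> s t u as_ st tb ucd; apply: D3P => // b''.
  by apply: BdP => //; rewrite as_ (le_trans st).
move=> u v s cu uv vd sab.
have := D4P u v s cu uv vd sab _ (swap_block b').
have -> : b' = swap_block (swap_block b') by case: b'.
apply=> b''; apply: BdP => //.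
by rewrite cu (le_trans uv).
Qed.

End Regularity.

Theorem proposition14 (R : realType) (V W S : finBanachType R)
  (F : completeNormedModType R) (p q a b c d : R)
  (omegaX omegaY : R -> R -> R)
  (X : R -> R -> tens R V (Num.truncn p).+1)
  (Y : R -> R -> tens R W (Num.truncn q).+1)
  (g : F -> S)
  (Z : R -> R ->
    {linear tens2 R V (Num.truncn p) W (Num.truncn q) -> F})
  (p_ge1 : 1 <= p) (q_ge1 : 1 <= q) (le_ab : a <= b) (le_cd : c <= d)
  (omegaX_control : control a b omegaX) (omegaY_control : control c d omegaY)
  (X_rough : rough_path p omegaX a b X) (Y_rough : rough_path q omegaY c d Y)
  (g_smooth : frechet_smooth g)
  (Z_controlled : controlled2 p q omegaX omegaY a b c d X Y Z) :
  controlled2 p q omegaX omegaY a b c d X Y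
    (fun t v => compose_ctrl g (Z t v) :
      {linear tens2 R V (Num.truncn p) W (Num.truncn q) -> S}).
Proof.
have p_gt0 : 0 < p by exact: lt_le_trans p_ge1.
have q_gt0 : 0 < q by exact: lt_le_trans q_ge1.
have X_Cpow : Cpow p omegaX a b X by case: X_rough => -[].
have Y_Cpow : Cpow q omegaY c d Y by case: Y_rough => -[].
have [Bd Bd0 [ZB ZK]] := controlled_bounded_compact p_gt0 q_gt0 le_ab
  omegaX_control omegaY_control X_Cpow Y_Cpow Z_controlled.
have [C1 C1P] := word_remainder1 omegaX_control Z_controlled.
have [C2 C2P] := word_remainder2 omegaY_control Z_controlled.
apply: controlled2_of_words => // w w'.
- have vanish t u : level_vanishing (kappa := Num.truncn p) (word_eval (Z t u)).
    by move=> v v'; exact: word_eval_longl.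
  have [] := @faa_di_bruno_remainder _ _ _ _ _ _ g p a b omegaX X R
    [set u | c <= u <= d] (fun t u => word_eval (Z t u)) g_smooth omegaX_control
    X_Cpow Bd C1 p_gt0 Bd0 vanish _ _ C1P (wseq w) (wseq w') (size_wseq w).
  + by move=> t u tab ucd b'; exact: ZB.
  + by move=> b'; have [K [Kc KP]] := ZK b'; exists K; split=> // t u;
    exact: KP.
  move=> C C0 CP; exists C => // s t u as_ st tb ucd.
  rewrite rem1_tword ?size_wseq // word_eval_compose ?size_wseq //.
  rewrite /cut_faa_di_bruno size_wseq.
  have -> : pairing (X s t) (fun v => word_eval
       (compose_ctrl g (Z s u) : {linear _ -> S}) (v ++ wseq w, wseq w')) =
     pairing (X s t) (fun v => cut_faa_di_bruno (kappa := Num.truncn p) g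
       (word_eval (Z s u)) (wseq w') (v ++ wseq w)).
    by apply: eq_bigr => v _; rewrite word_eval_compose ?size_wseq.
  exact: CP.
- have vanish t u :
      level_vanishing (kappa := Num.truncn q) (word_eval (Z u t) \o swap_block).
    by move=> v v'; exact: word_eval_longr.
  have [] := @faa_di_bruno_remainder _ _ _ _ _ _ g q c d omegaY Y R
    [set u | a <= u <= b] (fun t u => word_eval (Z u t) \o swap_block) g_smooth
    omegaY_control Y_Cpow Bd C2 q_gt0 Bd0 vanish _ _ C2P (wseq w') (wseq w)
    (size_wseq w').
  + by move=> t u tcd uab b'; exact: ZB.
  + move=> b'; have [K [Kc KP]] := ZK (swap_block b').
    by exists K; split=> // t u tcd uab; exact: KP.
  move=> C C0 CP; exists C => // s t u cs st td uab.
  rewrite rem2_tword ?size_wseq // word_eval_compose_swap ?size_wseq //.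
  rewrite /cut_faa_di_bruno size_wseq.
  have -> : pairing (Y s t) (fun v => word_eval
       (compose_ctrl g (Z u s) : {linear _ -> S}) (wseq w, v ++ wseq w')) =
     pairing (Y s t) (fun v => cut_faa_di_bruno (kappa := Num.truncn q) g
       (word_eval (Z u s) \o swap_block) (wseq w) (v ++ wseq w')).
    by apply: eq_bigr => v _; rewrite word_eval_compose_swap ?size_wseq.
  exact: CP.
Qed.
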